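(* Let $k$ be a field, $R=k[x,y]$, and let $E\subset R$ be a proper monomial ideal with $\dim_kR/E<\infty$. Then, with $V_i(E)$ and $\mathcal S(E)$ as in the context, the set $V_0(E)$ is an affine space over $k$, and the subsets $V_1(E)$, $V_2(E)$, $V_3(E)$ are also affine spaces, indeed coordinate subspaces of $V_0(E)$ (that is, there is an isomorphism of $V_0(E)$ with an affine space under which each of $V_1(E),V_2(E),V_3(E)$ corresponds to a subspace defined by the vanishing of some of the coordinates). Furthermore $$\dim V_i(E)=\begin{cases}\dim_k R/E+\min\{j: y^j\in E\} & \text{if } i=0,\\ \dim_k R/E & \text{if } i=1,\\ \dim_k R/E-\min\{j: x^j\in E\} & \text{if } i=2,\\ \#\mathcal S(E) & \text{if } i=3.\end{cases}$$
   Context: $k$ is an arbitrary field and $R=k[x,y]$ carries the lexicographic term order with $x>y$. For $0\ne f\in R$, $\mathrm{Lt}(f)$ is the largest monomial occurring in $f$; for an ideal $I$, $\mathrm{Lt}(I)$ is the monomial ideal generated by all $\mathrm{Lt}(f)$, $f\in I\setminus\{0\}$. Sets of ideals of $R$: - $V_0(E)=\{I : \mathrm{Lt}(I)=E\}$; - $V_1(E)=\{I : \mathrm{Lt}(I)=E \text{ and } y\in\sqrt I\}$; - $V_2(E)=\{I : \mathrm{Lt}(I)=E \text{ and } \sqrt I=(x,y)\}$; - $V_3(E)=\{I : \mathrm{Lt}(I)=E \text{ and } I \text{ is homogeneous (standard grading)}\}$. Affine variety structure on $V_0(E)$: an ideal $I\in V_0(E)$ has a unique reduced Gröbner basis, consisting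 of polynomials $f_m=m-\sum\lambda(m,m')m'$, one for each minimal monomial generator $m$ of $E$, where the sum is over the (finitely many) monomials $m'\notin E$ with $m'<m$. Sending $I$ to the vector of coefficients $\lambda(m,m')$ identifies $V_0(E)$ with a Zariski closed subset of an affine space $\mathbf A^N$ over $k$ (defined by the polynomial equations coming from Buchberger's criterion). Isomorphism means a bijection given by polynomials in both directions. Numerical data of $E$: $t=\min\{j:x^j\in E\}$; $m_i=\min\{j:x^{t-i}y^j\in E\}$ for $0\le i\le t$ (so $0=m_0<m_1\le\dots\le m_t$); $d_i=m_i-m_{i-1}$ for $1\le i\le t$; $u_{ij}=m_j-m_{i-1}+i-j$ for $1\le i\le t+1$, $1\le j\le t$; and $$\mathcal S(E)=\{(i,j): 1\le j<i\le t+1,\ 0\le u_{ij}<d_j\}.$$ *)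

(* Defs.v *)
From mathcomp Require Import all_boot all_order all_algebra.
From mathcomp Require Import mpoly.

Set Implicit Arguments.
Unset Strict Implicit.
Unset Printing Implicit Defensive.

Import GRing.Theory.
Local Open Scope ring_scope.

(* The ring k[x,y] is {mpoly k[2]}; the variable of index 0 is x and the one   *)
(* of index 1 is y.  Ideals are Prop-valued predicates on the ring, compared   *)
(* extensionally (eqI).                                                        *)

Definition varx (k : fieldType) : {mpoly k[2]} := 'X_(@ord0 1).
Definition vary (k : fieldType) : {mpoly k[2]} := 'X_(@ord_max 1).

Section Ideals.

Variable k : fieldType.
Local Notation R := {mpoly k[2]}.
Local Notation mon := 'X_{1..2}.
Implicit Types (I J G E S : R -> Prop) (m n : mon).

Definition eqI I J : Prop := forall f, I f <-> J f.

Definition is_ideal I : Prop :=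
  [/\ I 0, forall f g, I f -> I g -> I (f + g) & forall f g, I g -> I (f * g)].

Definition ideal_gen S : R -> Prop :=
  fun f => forall J, is_ideal J -> (forall s, S s -> J s) -> J f.

Definition radical I : R -> Prop := fun f => exists e : nat, I (f ^+ e).

Definition monomial_ideal I : Prop :=
  exists A : mon -> Prop, eqI I (ideal_gen (fun g => exists2 m, A m & g = 'X_[m])).

(* An ideal is homogeneous when it contains the homogeneous components (for    *)
(* total degree) of each of its elements.                                      *)
Definition homogeneous_ideal I : Prop :=
  forall f, I f -> forall d : nat, I (pihomog mdeg d f).

(* dim_k R/I = d: the classes of some b_0, ..., b_(d-1) are a k-basis of R/I.  *)
Definition quot_dim I (d : nat) : Prop :=
  exists b : 'I_d -> R, forall f : R,
    exists! c : 'rV[k]_d, I (f - \sum_i c 0 i *: b i).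

(* The order instance that mpoly puts on monomials is graded, hence this one.  *)
Definition lexlt m n : bool :=
  (m ord0 < n ord0)%N
  || ((m ord0 == n ord0) && (m (@ord_max 1) < n (@ord_max 1))%N).

Definition is_Lt (f : R) m : Prop :=
  m \in msupp f /\ forall n, n \in msupp f -> n != m -> lexlt n m.

(* Zero has no leading monomial, so it contributes nothing to Lt_ideal.        *)
Definition Lt_ideal S : R -> Prop :=
  ideal_gen (fun g => exists f m, [/\ S f, is_Lt f m & g = 'X_[m]]).

Definition V0 E I : Prop := is_ideal I /\ eqI (Lt_ideal I) E.
Definition V1 E I : Prop := V0 E I /\ radical I (vary k).
Definition V2 E I : Prop :=
  V0 E I /\ eqI (radical I) (ideal_gen (fun g => g = varx k \/ g = vary k)).
Definition V3 E I : Prop := V0 E I /\ homogeneous_ideal I.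

Definition reduced_groebner G I : Prop :=
  [/\ forall g, G g -> I g /\ exists2 m, is_Lt g m & g@_m = 1,
      eqI (Lt_ideal G) (Lt_ideal I)
    & forall g h m n, G g -> G h -> g <> h ->
        m \in msupp g -> is_Lt h n -> ~~ (n <= m)%MM].

Definition min_gen E m : Prop :=
  E 'X_[m] /\ forall n, E 'X_[n] -> (n <= m)%MM -> n = m.

(* c enumerates the index set of the coefficients lambda(m, m').               *)
Definition coef_index E (N : nat) (c : N.-tuple (mon * mon)) : Prop :=
  uniq c /\ forall m m', (m, m') \in c <->
    [/\ min_gen E m, ~ E 'X_[m'] & lexlt m' m].

(* f_m = m - sum_(m') lambda(m, m') m'                                         *)
Definition groebner_poly (N : nat) (c : N.-tuple (mon * mon)) (lam : 'rV[k]_N)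
    m : R :=
  'X_[m] - \sum_(i < N | (tnth c i).1 == m) lam 0 i *: 'X_[(tnth c i).2].

(* lam is the point of A^N representing I.                                     *)
Definition coef_vector E (N : nat) (c : N.-tuple (mon * mon)) I
    (lam : 'rV[k]_N) : Prop :=
  reduced_groebner
    (fun g => exists2 m, min_gen E m & g = groebner_poly c lam m) I.

End Ideals.

Definition poly_map (k : fieldType) (a b : nat) (F : b.-tuple {mpoly k[a]})
    (v : 'rV[k]_a) : 'rV[k]_b := \row_j (tnth F j).@[v 0].

(* psi is a bijection from k^n onto V_0(E) which, once V_0(E) is embedded in   *)
(* A^N by the coefficient vectors, is polynomial in both directions: G is psi  *)
(* read in A^N, and F restricts to its inverse.                                *)
Definition affine_space_iso (k : fieldType) (E : {mpoly k[2]} -> Prop)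
    (N : nat) (c : N.-tuple ('X_{1..2} * 'X_{1..2})) (n : nat)
    (psi : 'rV[k]_n -> {mpoly k[2]} -> Prop) : Prop :=
  [/\ forall a, V0 E (psi a),
      forall a b, eqI (psi a) (psi b) -> a = b,
      forall I, V0 E I -> exists a, eqI I (psi a)
    & exists (F : n.-tuple {mpoly k[N]}) (G : N.-tuple {mpoly k[n]}),
        (forall a lam, coef_vector E c (psi a) lam <-> lam = poly_map G a)
        /\ (forall a, poly_map F (poly_map G a) = a)].

(* Under psi, the members of V form the subspace a_j = 0 (j in J).             *)
Definition coord_subspace (k : fieldType) (n : nat)
    (psi : 'rV[k]_n -> {mpoly k[2]} -> Prop)
    (V : ({mpoly k[2]} -> Prop) -> Prop) (J : {set 'I_n}) : Prop :=
  forall a : 'rV[k]_n, V (psi a) <-> forall j, j \in J -> a 0 j = 0.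

Definition is_min (P : nat -> Prop) (j : nat) : Prop :=
  P j /\ forall i, P i -> (j <= i)%N.

(* These are integers: u_ij may be negative.                                   *)
Definition dE (m : nat -> nat) (i : nat) : int := (m i)%:Z - (m i.-1)%:Z.
Definition uE (m : nat -> nat) (i j : nat) : int :=
  (m j)%:Z - (m i.-1)%:Z + i%:Z - j%:Z.

Definition SE (t : nat) (m : nat -> nat) : {set 'I_t.+2 * 'I_t.+1} :=
  [set p : 'I_t.+2 * 'I_t.+1 |
    [&& (1 <= p.2)%N, (p.2 < p.1)%N, 0 <= uE m p.1 p.2
      & uE m p.1 p.2 < dE m p.2]].

(* Main.v *)
From HB Require Import structures.
Require Import Defs.
From mathcomp Require Import all_boot all_order all_algebra.
From mathcomp Require Import mpoly.
From mathcomp Require Import zify ring.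

(** Write R = k[y][x] and look at an ideal I with Lt(I) = E one power of x at a
    time.  The coefficients of x^r in the elements of I of x-degree at most r
    form an ideal of k[y], generated by a monic g_r whose degree [mu r] is the
    height of the r-th column of the staircase of E.  Any F_r in I of x-degree r
    with leading coefficient g_r, r = 0, 1, ..., form a k[y]-basis of I.  As
    x F_r lies in I, there are C_r monic of degree [D r = mu r - mu r.+1] and
    B_(r,l) in k[y] with g_r = C_r g_(r+1) and

      C_r F_(r+1) = x F_r - sum_(l <= r) B_(r,l) F_l.

    Adding to F_(r+1) a k[y]-combination of F_0, ..., F_r changes each B_(r,l)
    by an arbitrary multiple of C_r, so exactly one choice makes all of them of
    degree less than [D r] ([step_unique], [norm_basis_relations]).  Conversely
    C_r and B_(r,l) within these degree bounds can be prescribed freely: the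
    relations are solved by F_r = g_r H_r, where g_r = C_r ... C_(t-1) and H_r
    is monic of degree r in x and given by a recursion ([stair_basis]).  The
    relations are the columns of a Hilbert-Burch matrix of I, but the recursion
    avoids its minors.  So the coefficients of the C_r and of the B_(r,l) are
    coordinates on V_0(E); there are [(r + 2) * D r] of them for each r, which
    sums up to dim R/E + mu 0.

    The bijection is polynomial in both directions.  The reduced Groebner basis
    is obtained from the F_r by divisions by the g_r ([normal_form]), and the
    parameters are obtained from the reduced Groebner basis by the normalization
    described above ([norm_param]).  Both procedures divide by monic polynomials
    only, so they make sense over every commutative ring and commute with ring
    morphisms; applied to a point whose coordinates are indeterminates they
    produce the required polynomials.

    The three subfamilies are read off the same data.
    - The intersection of I with k[y] is generated by the product of the C_r,
      so y is nilpotent modulo I iff every C_r is a power of y.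
    - If so, every F_r with r < t vanishes at y = 0, hence I becomes principal
      there, generated by H_t(x, 0).  The recursion exhibits H_t(x, 0) as a
      product of polynomials whose lower coefficients are, up to sign, t of the
      parameters, one for each s < t; it is a power of x iff these t parameters
      vanish ([nilpotent_params]).
    - If I is homogeneous, replacing each F_r by its component of the expected
      degree again gives a normalized basis of I.  By uniqueness nothing has
      changed, so C_r = y^(D r) and B_(r,l) has at most one term, in the degree
      that makes the relation homogeneous ([homogeneous_params]). *)

Set Implicit Arguments.
Unset Strict Implicit.
Unset Printing Implicit Defensive.

Import GRing.Theory.
Import Pdiv.CommonRing Pdiv.RingMonic.
Local Open Scope ring_scope.

(** * Recursion on all earlier values *)

Section StrongRecursion.

Variables (T : Type) (x0 : T) (step : nat -> (nat -> T) -> T).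

Fixpoint history (r : nat) : nat -> T :=
  if r is r'.+1 then
    fun s => if (s <= r')%N then history r' s else step r' (history r')
  else fun=> x0.

(** The step from [r] to [r.+1] reads all the values at [0], ..., [r], as the
    recursions for a basis of an ideal do. *)
Definition strong_rec (r : nat) : T := history r r.

Lemma history_rec r s : (s <= r)%N -> history r s = strong_rec s.
Proof.
elim: r => [|r IHr]; first by rewrite leqn0 => /eqP ->.
rewrite leq_eqVlt => /predU1P[-> //|]; rewrite ltnS => sr /=.
by rewrite sr IHr.
Qed.

Lemma strong_recS r :
    (forall G, (forall s, (s <= r)%N -> G s = strong_rec s) ->
       step r G = step r strong_rec) ->
  strong_rec r.+1 = step r strong_rec.
Proof.
by move=> ext; rewrite /strong_rec /= ltnn; apply: ext => s; apply: history_rec.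
Qed.

Lemma strong_rec0 : strong_rec 0 = x0. Proof. by []. Qed.

End StrongRecursion.

Global Opaque strong_rec.

(** * Division along a staircase *)

Section Division.

Variable K : comNzRingType.
Local Notation P2 := {poly {poly K}}.
Implicit Types (F : nat -> P2) (p : P2).

(** The outer variable is x and the inner one y, so [F s] has x-degree at most
    [s] and its coefficient of x^s is a monic polynomial in y. *)
Definition staircase F : Prop :=
  forall s, (size (F s) <= s.+1)%N /\ (F s)`_s \is monic.

(** The coefficient of [F s] in the division of [p] by [F n.-1], ..., [F 0],
    performed from the highest power of x downwards. *)
Fixpoint stair_quo F n p (s : nat) : {poly K} :=
  if n is n'.+1 then
    let q := rdivp p`_n' (F n')`_n' in
    if s == n' then q else stair_quo F n' (p - q%:P * F n') s
  else 0.

Definition stair_rem F n p : P2 := p - \sum_(s < n) (stair_quo F n p s)%:P * F s.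

Lemma stair_rem_rec F n p :
  stair_rem F n.+1 p = stair_rem F n (p - (rdivp p`_n (F n)`_n)%:P * F n).
Proof.
rewrite /stair_rem big_ord_recr /= eqxx opprD addrA addrAC; congr (_ - _).
apply: eq_bigr => s _; case: eqP => // sn.
by have := ltn_ord s; rewrite sn ltnn.
Qed.

(** The divisors [F s] with [s < n] do not reach the powers x^n and above. *)
Lemma stair_rem_high F n p s : staircase F -> (n <= s)%N -> (stair_rem F n p)`_s = p`_s.
Proof.
move=> stF ns; rewrite coefB coef_sum big1 ?subr0 // => i _.
rewrite coefCM nth_default ?mulr0 //.
by apply: leq_trans (stF i).1 _; apply: leq_trans ns; apply: ltn_ord.
Qed.

(** The step that handles x^s leaves there a remainder modulo the monic leading
    coefficient of [F s], and the later steps do not touch that power of x. *)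
Lemma stair_rem_small F n p s :
  staircase F -> (s < n)%N -> (size ((stair_rem F n p)`_s)%R < size ((F s)`_s)%R)%N.
Proof.
move=> stF; elim: n p => // n IHn p; rewrite ltnS leq_eqVlt stair_rem_rec.
case/predU1P=> [->|/IHn //]; have [_ mon] := stF n.
rewrite stair_rem_high // coefB coefCM {1}(rdivp_eq mon p`_n).
by rewrite addrAC subrr add0r ltn_rmodpN0 ?monic_neq0.
Qed.

Lemma stair_rem_size F n p : staircase F -> (size p <= n)%N ->
  (size (stair_rem F n p) <= n)%N.
Proof.
move=> stF pn; apply/leq_sizeP => j nj; rewrite stair_rem_high //.
by rewrite nth_default // (leq_trans pn).
Qed.

Lemma eq_stair_quo F F' n p s : (forall i, (i < n)%N -> F i = F' i) ->
  stair_quo F n p s = stair_quo F' n p s.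
Proof.
elim: n p => //= n IHn p eqF; rewrite eqF //; case: ifP => // _.
by apply: IHn => i /ltnW; apply: eqF.
Qed.

End Division.

Section MapDivision.

Variables (K L : comNzRingType) (f : {rmorphism K -> L}).
Local Notation map1 := (map_poly f).
Local Notation map2 := (map_poly (map_poly f)).

(** Division by a monic polynomial is characterized by the degree of the
    remainder, and a monic polynomial keeps its degree under a ring morphism. *)
Lemma map_rdivp (p d : {poly K}) : d \is monic ->
  map1 (rdivp p d) = rdivp (map1 p) (map1 d).
Proof.
move=> mon; rewrite [p in RHS](rdivp_eq mon) rmorphD rmorphM /=.
rewrite rdivp_addl_mul_small ?monic_map //.
have -> : size (map1 d) = size d.
  by apply: size_map_poly_id0; rewrite (monicP mon) rmorph1 oner_eq0.
apply: leq_ltn_trans (size_poly _ _) _.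
by rewrite ltn_rmodpN0 ?monic_neq0.
Qed.

Lemma map_rmodp (p d : {poly K}) : d \is monic ->
  map1 (rmodp p d) = rmodp (map1 p) (map1 d).
Proof.
move=> mon; rewrite [p in RHS](rdivp_eq mon) rmorphD rmorphM /=.
rewrite rmodp_addl_mul_small ?monic_map //.
have -> : size (map1 d) = size d.
  by apply: size_map_poly_id0; rewrite (monicP mon) rmorph1 oner_eq0.
apply: leq_ltn_trans (size_poly _ _) _.
by rewrite ltn_rmodpN0 ?monic_neq0.
Qed.

Lemma map_stair_quo (F : nat -> {poly {poly K}}) n p s :
  (forall i, (i < n)%N -> (F i)`_i \is monic) ->
  map1 (stair_quo F n p s) = stair_quo (fun i => map2 (F i)) n (map2 p) s.
Proof.
elim: n p => /= [|n IHn] p stF; first by rewrite rmorph0.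
case: ifP => _; first by rewrite !coef_map map_rdivp ?stF.
rewrite IHn => [|i /ltnW /stF //].
by rewrite rmorphB rmorphM /= map_polyC !coef_map /= map_rdivp ?stF.
Qed.

Lemma map_stair_rem (F : nat -> {poly {poly K}}) n p :
  (forall i, (i < n)%N -> (F i)`_i \is monic) ->
  map2 (stair_rem F n p) = stair_rem (fun i => map2 (F i)) n (map2 p).
Proof.
move=> stF; rewrite rmorphB rmorph_sum /=; congr (_ - _).
by apply: eq_bigr => i _; rewrite rmorphM /= map_polyC /=; congr (_%:P * _);
  exact: map_stair_quo.
Qed.

End MapDivision.

Arguments stair_quo : simpl never.

(** * The basis with prescribed relations *)

Section Construction.

Variables (t : nat) (D : nat -> nat).
Hypothesis D_high : forall r, (t <= r)%N -> D r = 0%N.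

(** When [D r] is the drop of the staircase from column [r] to column [r.+1],
    this is the height of column [r]. *)
Definition mu r : nat := \sum_(r <= q < t) D q.

Lemma mu_rec r : mu r = (D r + mu r.+1)%N.
Proof.
rewrite /mu; case: (ltnP r t) => rt; first by rewrite big_ltn.
by rewrite D_high // !big_geq // ltnW.
Qed.

Lemma mu_high r : (t <= r)%N -> mu r = 0%N.
Proof. by move=> tr; rewrite /mu big_geq. Qed.

Lemma mu_mono r r' : (r <= r')%N -> (mu r' <= mu r)%N.
Proof.
by move=> /subnK <-; elim: (r' - r)%N => //= n; apply: leq_trans;
  rewrite addSn (mu_rec (n + r)%N) leq_addl.
Qed.

Section Ring.

Variable K : comNzRingType.
Local Notation P2 := {poly {poly K}}.
Implicit Types (a : nat -> nat -> nat -> K) (C : nat -> {poly K}) (F : nat -> P2).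

(** The polynomial C_r.  Its coefficients below the leading one are stored at the
    index [l = r.+1], which the polynomials B_(r,l) with [l <= r] leave free. *)
Definition diag_coef a r : {poly K} := 'X^(D r) + \poly_(p < D r) a r r.+1 p.
Definition low_coef a r l : {poly K} := \poly_(p < D r) a r l p.
Definition lead_prod C r : {poly K} := \prod_(r <= q < t) C q.

Definition shaped F : Prop :=
  staircase F /\ forall s, size ((F s)`_s)%R = (mu s).+1.

(** The columns of a Hilbert-Burch matrix of the ideal spanned by the [F r]. *)
Definition relations C (B : nat -> nat -> {poly K}) F : Prop :=
  forall r, (C r)%:P * F r.+1 = 'X * F r - \sum_(l < r.+1) (B r l)%:P * F l.

Definition monic_step a r (G : nat -> P2) : P2 :=
  'X * G r -
    \sum_(l < r.+1) (low_coef a r l * \prod_(l <= q < r) diag_coef a q)%:P * G l.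

(** The polynomials H_r, obtained by dividing the relations by the leading
    coefficient of [F r]; this is why the products of the C_q enter. *)
Definition monic_part a : nat -> P2 := strong_rec 1 (monic_step a).
Definition stair_basis a r : P2 := (lead_prod (diag_coef a) r)%:P * monic_part a r.

Lemma monic_part0 a : monic_part a 0 = 1. Proof. exact: strong_rec0. Qed.

Lemma monic_partS a r : monic_part a r.+1 = 'X * monic_part a r -
    \sum_(l < r.+1) (low_coef a r l * \prod_(l <= q <
      r) diag_coef a q)%:P * monic_part a l.
Proof.
apply: strong_recS => G eqG; rewrite /monic_step eqG //; congr (_ - _).
by apply: eq_bigr => l _; rewrite eqG // -ltnS.
Qed.

Lemma size_diag_coef a r : size (diag_coef a r) = (D r).+1.
Proof.
by rewrite size_polyDl ?size_polyXn ?ltnS ?size_poly.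
Qed.

Lemma diag_coef_monic a r : diag_coef a r \is monic.
Proof.
by rewrite monicE lead_coefDl ?lead_coefXn // size_polyXn ltnS size_poly.
Qed.

Lemma size_low_coef a r l : (size (low_coef a r l) <= D r)%N.
Proof. exact: size_poly. Qed.

Lemma low_coef_high a r l : (t <= r)%N -> low_coef a r l = 0.
Proof.
by move=> tr; apply/eqP; rewrite -size_poly_leq0 -(D_high tr) size_low_coef.
Qed.

Lemma diag_coef_high a r : (t <= r)%N -> diag_coef a r = 1.
Proof. by move=> tr; rewrite /diag_coef D_high // expr0 poly_def big_ord0 addr0. Qed.

Lemma lead_prod_high C r : (t <= r)%N -> lead_prod C r = 1.
Proof. by move=> tr; rewrite /lead_prod big_geq. Qed.

Lemma lead_prod_rec C r : (forall q, (t <= q)%N -> C q = 1) ->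
  lead_prod C r = C r * lead_prod C r.+1.
Proof.
rewrite /lead_prod => Ch; case: (ltnP r t) => rt; first by rewrite big_ltn.
by rewrite Ch // !big_geq ?mul1r // ltnW.
Qed.

(** In particular the leading coefficient of [F r] divides that of [F l] for
    [l <= r], which makes the division that defines H_r possible. *)
Lemma lead_prod_split C l r : (forall q, (t <= q)%N -> C q = 1) -> (l <= r)%N ->
  \prod_(l <= q < r) C q * lead_prod C r = lead_prod C l.
Proof.
move=> Ch /subnK <-; elim: (r - l)%N => [|n IHn] /=.
  by rewrite big_geq ?mul1r.
by rewrite addSn big_nat_recr /= ?leq_addl // -mulrA -lead_prod_rec.
Qed.

Lemma lead_prod_monic C r : (forall q, C q \is monic) -> lead_prod C r \is monic.
Proof. by move=> mon; apply: monic_prod => q _. Qed.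

(** Multiplying the recursion for H_(r+1) by g_r restores the relation: on the
    left g_r = C_r g_(r+1), and on the right g_r times the product of C_l, ...,
    C_(r-1) is g_l. *)
Lemma stair_basis_relations a : relations (diag_coef a) (low_coef a) (stair_basis a).
Proof.
move=> r; have gr := lead_prod_rec r (diag_coef_high a).
rewrite /stair_basis mulrA -polyCM -gr monic_partS mulrBr mulrCA; congr (_ - _).
rewrite big_distrr /=; apply: eq_bigr => l _; rewrite !mulrA -!polyCM.
congr (_%:P * _); rewrite -(lead_prod_split (diag_coef_high a) (leq_ord l)).
by ring.
Qed.

Lemma monic_part_monic a r : size (monic_part a r) = r.+1 /\ monic_part a r \is monic.
Proof.
elim: r {-2}r (leqnn r) => [|n IHn] r.
  by rewrite leqn0 => /eqP ->; rewrite monic_part0 size_poly1 monic1.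
rewrite leq_eqVlt => /predU1P[->|]; last exact: IHn.
have [sz mon] := IHn n (leqnn n).
have sX : size ('X * monic_part a n) = n.+2.
  by rewrite mulrC size_mulX ?monic_neq0 ?sz.
have lt : (size (- (\sum_(l < n.+1) (low_coef a n l * \prod_(l <= q <
  n) diag_coef a q)%:P * monic_part a l))%R < size ('X * monic_part a n)%R)%N.
  rewrite sX ltnS size_polyN; apply: (leq_trans (size_sum _ _ _)).
  apply/bigmax_leqP => l _; apply: leq_trans (size_polyMleq _ _) _.
  have [-> _] := IHn l (leq_ord l).
  apply: leq_trans (_ : (1 + l.+1).-1 <= _)%N; last by rewrite add1n /= ltn_ord.
  by rewrite -!subn1 leq_sub2r // leq_add2r size_polyC_leq1.
rewrite monic_partS size_polyDl // sX; split=> //.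
by rewrite monicE lead_coefDl // mulrC lead_coefMX -monicE.
Qed.

Lemma size_lead_prod C r : (forall q, C q \is monic) ->
  (forall q, size (C q) = (D q).+1) ->
  size (lead_prod C r) = (mu r).+1.
Proof.
move=> mon sC; rewrite /lead_prod /mu; elim/big_rec2: _ => [|q n p _ ih].
  by rewrite size_poly1.
have p0 : p != 0 by rewrite -size_poly_eq0 ih.
by rewrite size_monicM // sC ih addSn /= addnS.
Qed.

Lemma stair_basis_lead a r : size (stair_basis a r) = r.+1 /\
  (stair_basis a r)`_r = lead_prod (diag_coef a) r.
Proof.
have [sz mon] := monic_part_monic a r.
have mg : lead_prod (diag_coef a) r \is monic by apply: lead_prod_monic;
  apply: diag_coef_monic.
have e : (stair_basis a r)`_r = lead_prod (diag_coef a) r.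
  rewrite coefCM; move: mon; rewrite monicE lead_coefE sz /= => /eqP ->.
  by rewrite mulr1.
split=> //; apply/eqP; rewrite eqn_leq; apply/andP; split.
  apply: leq_trans (size_polyMleq _ _) _; rewrite sz addnS /=.
  by rewrite -[X in (_ <= X)%N]add1n leq_add2r size_polyC_leq1.
rewrite ltnNge; apply/negP => le; move: e; rewrite nth_default // => e.
by rewrite -e monicE lead_coef0 eq_sym oner_eq0 in mg.
Qed.

Lemma stair_basis_staircase a : staircase (stair_basis a).
Proof.
by move=> s; have [-> ->] := stair_basis_lead a s; rewrite leqnn lead_prod_monic //;
  apply: diag_coef_monic.
Qed.

End Ring.

Section Map.

Variables (K L : comNzRingType) (f : {rmorphism K -> L}) (a : nat -> nat -> nat -> K).
Local Notation fa := (fun r l p => f (a r l p)).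
Local Notation map1 := (map_poly f).
Local Notation map2 := (map_poly (map_poly f)).

Lemma map_low_coef r l : map1 (low_coef a r l) = low_coef fa r l.
Proof.
by apply/polyP => i; rewrite coef_map !coef_poly; case: ifP => //=; rewrite rmorph0.
Qed.

Lemma map_diag_coef r : map1 (diag_coef a r) = diag_coef fa r.
Proof.
rewrite /diag_coef rmorphD /= map_polyXn; congr (_ + _).
exact: (map_low_coef r r.+1).
Qed.

Lemma map_monic_part r : map2 (monic_part a r) = monic_part fa r.
Proof.
elim: r {-2}r (leqnn r) => [|n IHn] r.
  by rewrite leqn0 => /eqP ->; rewrite !monic_part0 rmorph1.
rewrite leq_eqVlt => /predU1P[->|]; last exact: IHn.
rewrite !monic_partS rmorphB rmorphM /= map_polyX IHn //; congr (_ - _).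
rewrite rmorph_sum; apply: eq_bigr => l _;
  rewrite rmorphM /= map_polyC /= IHn ?leq_ord //.
congr (_%:P * _); rewrite rmorphM rmorph_prod /= map_low_coef; congr (_ * _).
by apply: eq_bigr => q _; apply: map_diag_coef.
Qed.

(** The basis at a point is the specialization of the basis at the generic
    point; this is the source of polynomiality. *)
Lemma map_stair_basis r : map2 (stair_basis a r) = stair_basis fa r.
Proof.
rewrite /stair_basis rmorphM /= map_polyC map_monic_part; congr (_%:P * _).
by rewrite /= rmorph_prod; apply: eq_bigr => q _; apply: map_diag_coef.
Qed.

End Map.

End Construction.

(** * Ideals with prescribed leading coefficients *)

Section Ideals.

Variables (t : nat) (D : nat -> nat).
Hypothesis D_high : forall r, (t <= r)%N -> D r = 0%N.
Local Notation mu := (mu t D).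

Variable k : fieldType.
Local Notation shaped := (@shaped t D k).
Local Notation P2 := {poly {poly k}}.
Implicit Types (J : P2 -> Prop) (F : nat -> P2) (p : P2).

(** The span over k[y]; it is an ideal as soon as it is stable under x. *)
Definition yspan F p : Prop :=
  exists n (q : nat -> {poly k}), p = \sum_(s < n) (q s)%:P * F s.

(** The ideals with initial ideal given by [mu]: the field [lead_min] says that
    no leading monomial lies below the staircase, [lead_ex] that the lowest monomial
    of E in each column is a leading monomial. *)
Record lead_ideal J : Prop := LeadIdeal {
  lead0 : J 0;
  leadD : forall p q, J p -> J q -> J (p + q);
  leadM : forall p q, J q -> J (p * q);
  lead_min : forall p r, J p -> (size p <= r.+1)%N -> (size (p`_r)%R <= mu r)%N ->
    p`_r = 0;
  lead_ex : forall r, exists p, [/\ J p, (size p <= r.+1)%N, p`_r \is monic &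
    size (p`_r)%R = (mu r).+1]
}.

Lemma leadN J p : lead_ideal J -> J p -> J (- p).
Proof. by move=> lJ Jp; rewrite -mulN1r; apply: leadM. Qed.

Lemma leadB J p q : lead_ideal J -> J p -> J q -> J (p - q).
Proof. by move=> lJ Jp Jq; apply: leadD => //; apply: leadN. Qed.

Lemma lead_sum J n (q : nat -> P2) F : lead_ideal J ->
  (forall s, (s < n)%N -> J (F s)) -> J (\sum_(s < n) q s * F s).
Proof.
move=> lJ; elim: n => [|n IHn] JF; first by rewrite big_ord0; apply: lead0.
rewrite big_ord_recr /=; apply: leadD => //; last by apply: leadM => //; apply: JF.
by apply: IHn => s /ltnW; apply: JF.
Qed.

(** The highest power of x in such a [p] would give a leading monomial of [J]
    below the staircase. *)
Lemma std_eq0 J p : lead_ideal J -> J p ->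
  (forall s, (size (p`_s)%R <= mu s)%N) -> p = 0.
Proof.
move=> lJ Jp std; apply/eqP; apply: contraT => p0.
have sp : (0 < size p)%N by rewrite size_poly_gt0.
have := lead_min (r := (size p).-1) lJ Jp; rewrite prednK // => h.
by have /eqP := h (leqnn _) (std _); rewrite -lead_coefE lead_coef_eq0 (negPf p0).
Qed.

Lemma lead_ideal_rem0 J F n p : lead_ideal J -> shaped F ->
  (forall s, (s < n)%N -> J (F s)) ->
  J p -> (size p <= n)%N -> stair_rem F n p = 0.
Proof.
move=> lJ [stF szF] JF Jp pn; apply: (std_eq0 lJ).
  by apply: leadB => //; apply: (lead_sum (fun s => (stair_quo F n p s)%:P) lJ).
move=> s; case: (ltnP s n) => sn.
  by rewrite -ltnS -szF stair_rem_small.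
by rewrite nth_default ?size_poly0 // (leq_trans (stair_rem_size stF pn)).
Qed.

(** The remainder of an element of [J] under division by the [F s] lies in [J]
    and below the staircase, so it is zero. *)
Lemma lead_ideal_span J F p : lead_ideal J -> shaped F -> (forall s, J (F s)) ->
  J p <-> yspan F p.
Proof.
move=> lJ shF JF; split=> [Jp|[n [q ->]]]; last first.
  exact: (lead_sum (fun s => (q s)%:P) lJ).
exists (size p), (stair_quo F (size p) p); apply/eqP; rewrite -subr_eq0; apply/eqP.
exact: (lead_ideal_rem0 lJ shF (fun s _ => JF s) Jp).
Qed.

(** The highest term of such a combination is alone in its power of x. *)
Lemma lead_eq0 F n (q : nat -> {poly k}) : staircase F ->
  \sum_(s < n) (q s)%:P * F s = 0 -> forall s, (s < n)%N -> q s = 0.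
Proof.
move=> stF; elim: n => // n IHn; rewrite big_ord_recr /= => e0.
have qn : q n = 0.
  have /eqP := congr1 (fun p : P2 => p`_n) e0; rewrite coefD coef_sum big1 ?add0r.
    rewrite coefCM coef0 mulf_eq0 => /orP[/eqP //|].
    by rewrite (negPf (monic_neq0 (stF n).2)).
  move=> i _; rewrite coefCM nth_default ?mulr0 //.
  exact: leq_trans (stF i).1 (ltn_ord i).
move: e0; rewrite qn mul0r addr0 => e0 s; rewrite ltnS leq_eqVlt.
by case/predU1P=> [-> //|]; apply: IHn.
Qed.

Lemma size_span F n (q : nat -> {poly k}) : staircase F ->
  (size (\sum_(s < n) (q s)%:P * F s)%R <= n)%N.
Proof.
move=> stF; apply: leq_trans (size_sum _ _ _) _; apply/bigmax_leqP => s _.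
apply: leq_trans (ltn_ord s); apply: leq_trans (stF s).1.
rewrite mul_polyC; exact: size_scale_leq.
Qed.

Lemma span_lead F p : staircase F -> yspan F p ->
  forall r, (size p <= r.+1)%N -> exists q, p`_r = q * (F r)`_r.
Proof.
move=> stF [n [q ->]] r; elim: n r => [|n IHn] r.
  by exists 0; rewrite big_ord0 coef0 mul0r.
move=> sz; case: (ltngtP n r) => nr.
- exists 0; rewrite mul0r nth_default //; apply: leq_trans nr.
  exact: size_span.
- suff qn : q n = 0.
    by move: sz; rewrite big_ord_recr /= qn mul0r addr0; apply: IHn.
  apply/eqP; move: sz => /leq_sizeP/(_ n nr); rewrite big_ord_recr coefD coef_sum /=.
  rewrite big1 ?add0r => [|i _].
    by move=> /eqP; rewrite coefCM mulf_eq0 (negPf (monic_neq0 (stF n).2)) orbF.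
  rewrite coefCM nth_default ?mulr0 //.
  exact: leq_trans (stF i).1 (ltn_ord i).
exists (q r); rewrite -nr big_ord_recr coefD coef_sum /= big1 ?add0r ?coefCM //.
move=> i _; rewrite coefCM nth_default ?mulr0 //.
exact: leq_trans (stF i).1 (ltn_ord i).
Qed.

Lemma spanD F p q : yspan F p -> yspan F q -> yspan F (p + q).
Proof.
move=> [n [a ->]] [n' [b ->]].
pose cut m (c : nat -> {poly k}) s := if (s < m)%N then c s else 0.
exists (maxn n n'), (fun s => cut n a s + cut n' b s).
have cutE m (c : nat -> {poly k}) M : (m <= M)%N ->
    \sum_(s < m) (c s)%:P * F s = \sum_(s < M) (cut m c s)%:P * F s.
  move=> mM; rewrite (big_ord_widen M (fun s => (c s)%:P * F s) mM) big_mkcond.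
  by apply: eq_bigr => s _; rewrite /cut; case: ifP => //; rewrite mul0r.
rewrite (cutE n a _ (leq_maxl n n')) (cutE n' b _ (leq_maxr n n')) -big_split /=.
by apply: eq_bigr => s _; rewrite polyCD mulrDl.
Qed.

Lemma span0 F : yspan F 0.
Proof. by exists 0%N, (fun=> 0); rewrite big_ord0. Qed.

Lemma span_sum F n (G : nat -> P2) :
  (forall s, (s < n)%N -> yspan F (G s)) -> yspan F (\sum_(s < n) G s).
Proof.
elim: n => [|n IHn] FG; first by rewrite big_ord0; apply: span0.
rewrite big_ord_recr; apply: spanD; last exact: FG.
by apply: IHn => s /ltnW; apply: FG.
Qed.

Lemma spanZ F (c : {poly k}) p : yspan F p -> yspan F (c%:P * p).
Proof.
move=> [n [q ->]]; exists n, (fun s => c * q s); rewrite big_distrr /=.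
by apply: eq_bigr => s _; rewrite polyCM mulrA.
Qed.

Lemma span_gen F s : yspan F (F s).
Proof.
exists s.+1, (fun i => (i == s)%:R); rewrite big_ord_recr /= eqxx mul1r big1 ?add0r //.
by move=> i _; rewrite ltn_eqF ?mul0r.
Qed.

(** The relations express x [F s] in terms of [F s.+1] and the earlier ones. *)
Lemma spanX F C B p : relations C B F -> yspan F p -> yspan F ('X * p).
Proof.
move=> rel [n [q ->]]; rewrite big_distrr /=.
apply: (span_sum (G := fun s => 'X * ((q s)%:P * F s))) => s _.
rewrite mulrCA; apply: spanZ; have /eqP := rel s; rewrite eq_sym subr_eq => /eqP ->.
apply: spanD; first by apply: spanZ; apply: span_gen.
apply: (span_sum (G := fun l => (B s l)%:P * F l)) => l _.
by apply: spanZ; apply: span_gen.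
Qed.

Lemma spanM F C B p q : relations C B F -> yspan F q -> yspan F (p * q).
Proof.
move=> rel; elim/poly_ind: p => [|p c IH] Fq; first by rewrite mul0r; apply: span0.
rewrite mulrDl; apply: spanD; last exact: spanZ.
by rewrite mulrAC mulrC; apply: (spanX rel); apply: IH.
Qed.

(** The leading coefficient of a combination of the [F s] is a multiple of that of
    the last [F s] involved, so it cannot have smaller degree. *)
Lemma span_lead_ideal F C B : shaped F -> relations C B F -> lead_ideal (yspan F).
Proof.
move=> [stF szF] rel; split.
- exact: span0.
- exact: spanD.
- by move=> p q; apply: (spanM _ rel).
- move=> p r Fp sp; have [q ->] := span_lead stF Fp sp.
  have [-> | q0] := eqVneq q 0; first by rewrite mul0r.
  rewrite size_Mmonic ?(stF r).2 // szF addnS /=.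
  by rewrite -[X in (_ <= X)%N]add0n leq_add2r leqn0 size_poly_eq0 (negPf q0).
move=> r; exists (F r); split; [exact: span_gen|exact: (stF r).1|exact: (stF r).2|].
exact: szF.
Qed.

Lemma stair_basis_shaped a : shaped (stair_basis t D a).
Proof.
split; first exact: stair_basis_staircase.
move=> s; have [_ ->] := stair_basis_lead t D a s.
by rewrite (size_lead_prod t (D := D)) // => q;
  [apply: diag_coef_monic|apply: size_diag_coef].
Qed.

(** The ideal with parameters [a]. *)
Definition span_ideal a : P2 -> Prop := yspan (stair_basis t D a).

Lemma span_ideal_lead_ideal a : lead_ideal (span_ideal a).
Proof.
exact: span_lead_ideal (stair_basis_shaped a) (stair_basis_relations D_high a).
Qed.

Lemma lead_unique J p q r : lead_ideal J -> J p -> J q ->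
  (size p <= r.+1)%N -> (size q <= r.+1)%N -> p`_r \is monic -> q`_r \is monic ->
  size (p`_r)%R = (mu r).+1 -> size (q`_r)%R = (mu r).+1 -> p`_r = q`_r.
Proof.
move=> lJ Jp Jq sp sq mp mq zp zq; apply/eqP; rewrite -subr_eq0 -coefB; apply/eqP.
apply: (lead_min lJ (leadB lJ Jp Jq)).
  by apply: leq_trans (size_polyD _ _) _; rewrite size_polyN geq_max sp.
rewrite coefB; apply/leq_sizeP => j; rewrite leq_eqVlt => /predU1P[<-|lt].
  rewrite coefB; move: mp mq; rewrite !monicE !lead_coefE zp zq /= => /eqP -> /eqP ->.
  by rewrite subrr.
by rewrite coefB (nth_default 0 (s := (p`_r)%R)) ?zp // (nth_default 0 (s :=
  (q`_r)%R)) ?zq // subrr.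
Qed.

(** Both [F'] and [F r.+1] have the same leading coefficient, so they differ by a
    combination of [F 0], ..., [F r] with coefficients q_s.  Subtracting the
    relations gives C q_s = B_s - B'_s, and the right-hand side has smaller degree
    than C unless q_s = 0. *)
Lemma step_unique J F (F' : P2) r (C : {poly k}) (B B' : nat -> {poly k}) :
  lead_ideal J -> shaped F -> (forall s, (s <= r.+1)%N -> J (F s)) ->
  C != 0 ->
  (forall s, (s <= r)%N -> (size (B s) < size C)%N) ->
  (forall s, (s <= r)%N -> (size (B' s) < size C)%N) ->
  J F' -> (size F' <= r.+2)%N -> (F'`_r.+1)%R \is monic ->
    size ((F'`_r.+1)%R)%R = (mu r.+1).+1 ->
  C%:P * F r.+1 = 'X * F r - \sum_(l < r.+1) (B l)%:P * F l ->
  C%:P * F' = 'X * F r - \sum_(l < r.+1) (B' l)%:P * F l ->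
  F' = F r.+1 /\ forall s, (s <= r)%N -> B' s = B s.
Proof.
move=> lJ shF JF C0 sB sB' JF' szF' monF' lF' rel rel'.
have [stF szF] := shF.
have sd : (size (F' - F r.+1)%R <= r.+1)%N.
  apply/leq_sizeP => j; rewrite leq_eqVlt => /predU1P[<-|lt]; rewrite coefB.
    apply/eqP; rewrite subr_eq0; apply/eqP.
    by apply: (lead_unique lJ JF' (JF _ (leqnn _))) => //;
      [apply: (stF _).1|apply: (stF _).2].
  by rewrite !nth_default ?subrr //;
    [apply: leq_trans (stF _).1 lt|apply: leq_trans szF' lt].
have := lead_ideal_rem0 lJ shF (fun s (h : (s < r.+1)%N) =>
  JF s (ltnW h)) (leadB lJ JF' (JF _ (leqnn _))) sd.
rewrite /stair_rem; set q := stair_quo _ _ _ => /eqP; rewrite subr_eq0 => /eqP eqd.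
have e0 : \sum_(s < r.+1) (C * q s + (B' s - B s))%:P * F s = 0.
  transitivity (C%:P * (F' - F r.+1) + \sum_(s < r.+1) (B' s)%:P * F s - \sum_(s <
    r.+1) (B s)%:P * F s).
    rewrite eqd big_distrr /= -big_split -sumrB /=; apply: eq_bigr => s _.
    by rewrite !polyCD polyCN polyCM; ring.
  by rewrite mulrBr rel rel'; ring.
have q0 s : (s <= r)%N -> q s = 0.
  move=> sr; have := lead_eq0 (q := fun s => C * q s + (B' s - B s)) stF e0 sr.
  have [-> //|qs0 /eqP] := eqVneq (q s) 0; rewrite addr_eq0 => /eqP eqs.
  have : (size (C * q s)%R < size C)%N.
    rewrite eqs size_polyN; apply: leq_ltn_trans (size_polyD _ _) _.
    by rewrite size_polyN gtn_max sB ?sB'.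
  rewrite size_mul // -subn1 ltnNge => /negP[].
  by rewrite -addnBA ?leq_addr // size_poly_gt0.
split=> [|s sr]; last first.
  have := lead_eq0 (q := fun s => C * q s + (B' s - B s)) stF e0 sr;
    rewrite q0 // mulr0 add0r => /eqP.
  by rewrite subr_eq0 => /eqP.
apply/eqP; rewrite -subr_eq0 eqd; apply/eqP; apply: big1 => s _.
by rewrite q0 ?mul0r // leq_ord.
Qed.

Definition param_eq (a b : nat -> nat -> nat -> k) : Prop :=
  forall r l (p : nat), (r < t)%N -> (l <= r.+1)%N -> (p < D r)%N -> a r l p = b r l p.

(** The leading coefficients are determined by the ideal, hence so are the C_r;
    then [step_unique] determines the basis and the B_(r,l) step by step. *)
Lemma span_ideal_inj a b : (forall p, span_ideal a p -> span_ideal b p) -> param_eq a b.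
Proof.
move=> sub; have lJ := span_ideal_lead_ideal b.
have Ja s : span_ideal b (stair_basis t D a s) by apply: sub; apply: span_gen.
have Jb s : span_ideal b (stair_basis t D b s) by apply: span_gen.
have [[sta sza] [stb szb]] := (stair_basis_shaped a, stair_basis_shaped b).
have eqg r : lead_prod t (diag_coef D a) r = lead_prod t (diag_coef D b) r.
  rewrite -(proj2 (stair_basis_lead t D a r));
    apply: etrans (proj2 (stair_basis_lead t D b r)).
  by apply: (lead_unique lJ (Ja r) (Jb r));
    [exact: (sta r).1|exact: (stb r).1|exact: (sta r).2|exact: (stb r).2|exact:
      sza|exact: szb].
have eqc r : diag_coef D a r = diag_coef D b r.
  have := eqg r; rewrite (lead_prod_rec r (diag_coef_high D_high a)).
  rewrite (lead_prod_rec r (diag_coef_high D_high b)) eqg.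
  by apply: mulIf; apply: monic_neq0; apply: lead_prod_monic; apply: diag_coef_monic.
have eqF r : stair_basis t D a r = stair_basis t D b r /\
    forall r', (r' < r)%N -> forall s, (s <= r')%N ->
      low_coef D a r' s = low_coef D b r' s.
  elim: r {-2}r (leqnn r) => [|n IHn] r.
    rewrite leqn0 => /eqP ->; split=> [|//].
    by rewrite /stair_basis !monic_part0 eqg.
  rewrite leq_eqVlt => /predU1P[->|]; last exact: IHn.
  have [eF eB] : stair_basis t D a n.+1 = stair_basis t D b n.+1 /\
      forall s, (s <= n)%N -> low_coef D a n s = low_coef D b n s.
    apply: (step_unique (C := diag_coef D b n) lJ (stair_basis_shaped b)) => //.
    - by rewrite monic_neq0 ?diag_coef_monic.
    - by move=> s _; rewrite size_diag_coef ltnS size_low_coef.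
    - by move=> s _; rewrite size_diag_coef ltnS size_low_coef.
    - exact: (sta _).1.
    - exact: (sta _).2.
    - exact: (stair_basis_relations D_high b n).
    rewrite -eqc (stair_basis_relations D_high a n) (IHn n (leqnn n)).1.
    congr (_ - _); apply: eq_bigr => l _.
    by rewrite (IHn l (leq_ord l)).1.
  split=> [|r']; first exact: eF.
  rewrite ltnS leq_eqVlt => /predU1P[->|rn]; first exact: eB.
  by have [_ eB'] := IHn n (leqnn n); apply: eB' rn.
move=> r l p rt; rewrite leq_eqVlt => /predU1P[->|lr] pD.
  have := congr1 (fun q : {poly k} => q`_p) (eqc r).
  by rewrite !coefD !coefXn ltn_eqF // !add0r !coef_poly pD.
have [_ /(_ r (leqnn _) l lr)] := eqF r.+1.
by move=> /(congr1 (fun q : {poly k} => q`_p)); rewrite !coef_poly pD.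
Qed.

Lemma eq_span_ideal a b p : param_eq a b -> span_ideal a p -> span_ideal b p.
Proof.
move=> eqab [n [q ->]]; exists n, q; apply: eq_bigr => s _.
have eqB r l : (l <= r.+1)%N -> (r < t)%N -> low_coef D a r l = low_coef D b r l.
  move=> lr rt; apply/polyP => i; rewrite !coef_poly; case: ifP => // iD.
  exact: eqab.
have eqC r : diag_coef D a r = diag_coef D b r.
  case: (ltnP r t) => rt; last by rewrite !(diag_coef_high D_high).
  by congr (_ + _); apply: (eqB r r.+1).
have eqH r : monic_part D a r = monic_part D b r.
  elim: r {-2}r (leqnn r) => [|m IHm] r.
    by rewrite leqn0 => /eqP ->.
  rewrite leq_eqVlt => /predU1P[->|]; last exact: IHm.
  rewrite !monic_partS (IHm m (leqnn m)); congr (_ - _); apply: eq_bigr => l _.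
  rewrite (IHm l (leq_ord l)); congr ((_ * _)%:P * _).
    case: (ltnP m t) => mt; first by apply: eqB => //; apply: ltnW.
    by rewrite !(low_coef_high D_high).
  by apply: eq_bigr.
rewrite /stair_basis eqH; congr (_ * (_%:P * _)).
exact: eq_bigr.
Qed.

End Ideals.

(** * Normalizing a leading family *)

(** The leading term of [p] comes from the product of the quotient by [d]. *)
Lemma rdivp_monic (K : comNzRingType) (p d : {poly K}) :
  p \is monic -> d \is monic -> (size d <= size p)%N ->
  rdivp p d \is monic /\ size (rdivp p d) = (size p - size d).+1.
Proof.
move=> mp md dp; have e := rdivp_eq md p.
have sr : (size (rmodp p d) < size d)%N by rewrite ltn_rmodpN0 ?monic_neq0.
have q0 : rdivp p d != 0.
  by apply: contraL dp => /eqP q0; rewrite -ltnNge {1}e q0 mul0r add0r.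
have sd : (0 < size d)%N by rewrite size_poly_gt0 monic_neq0.
have sq : (0 < size (rdivp p d))%N by rewrite size_poly_gt0.
have sqd := size_Mmonic q0 md.
have lt : (size (rmodp p d) <
  size (rdivp p d * d)%R)%N by rewrite sqd -(prednK sq) addSn /= (leq_trans sr)
    ?leq_addl.
split; first by move: mp; rewrite {1}e !monicE lead_coefDl // lead_coef_Mmonic.
by rewrite {2}e size_polyDl // sqd -(prednK sq) addSn /= addnK prednK.
Qed.

Section Normalization.

Variables (t : nat) (D : nat -> nat).
Hypothesis D_high : forall r, (t <= r)%N -> D r = 0%N.
Local Notation mu := (mu t D).
Local Notation shaped := (shaped t D).

Section Ring.

Variable K : comNzRingType.
Local Notation P2 := {poly {poly K}}.
Variable f : nat -> P2.

(** One step of the normalization of a leading family [f].  Dividing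
    [x F_r - C f_(r+1)] by [F 0], ..., [F r] gives quotients b_s; the multiple of
    C in each b_s is absorbed into [F r.+1] and the remainder becomes B_(r,s). *)
Definition norm_step r (G : nat -> P2) : P2 :=
  let c := rdivp (G r)`_r (f r.+1)`_r.+1 in
  let b := stair_quo G r.+1 ('X * G r - c%:P * f r.+1) in
  f r.+1 + \sum_(s < r.+1) (rdivp (b s) c)%:P * G s.

Definition norm_basis : nat -> P2 := strong_rec (f 0) norm_step.
Definition norm_diag r : {poly K} := rdivp (norm_basis r)`_r (f r.+1)`_r.+1.
Definition norm_quo r :=
  stair_quo norm_basis r.+1 ('X * norm_basis r - (norm_diag r)%:P * f r.+1).
(** Reduction modulo C_r brings the coefficients B_(r,l) within the degree bound
    that makes them unique. *)
Definition norm_low r l : {poly K} := rmodp (norm_quo r l) (norm_diag r).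
Definition norm_param r l (p : nat) : K :=
  if l == r.+1 then (norm_diag r)`_p else (norm_low r l)`_p.

Lemma norm_basis0 : norm_basis 0 = f 0. Proof. exact: strong_rec0. Qed.

Lemma norm_basisS r :
  norm_basis r.+1 = f r.+1 + \sum_(s <
    r.+1) (rdivp (norm_quo r s) (norm_diag r))%:P * norm_basis s.
Proof.
apply: strong_recS => G eqG; rewrite /norm_step (eqG r (leqnn r)); congr (_ + _).
by apply: eq_bigr => s _; rewrite (@eq_stair_quo _ G norm_basis) // eqG // -ltnS.
Qed.

Hypothesis shf : shaped f.

(** The correction of [f r.+1] has x-degree at most [r]. *)
Lemma norm_basis_lead r : (size (norm_basis r) <= r.+1)%N /\
  (norm_basis r)`_r = (f r)`_r.
Proof.
elim: r {-2}r (leqnn r) => [|n IHn] r.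
  by rewrite leqn0 => /eqP ->; rewrite norm_basis0; split=> //; apply: (shf.1 0).1.
rewrite leq_eqVlt => /predU1P[->|]; last exact: IHn.
have lo : (size (\sum_(s <
  n.+1) (rdivp (norm_quo n s) (norm_diag n))%:P * norm_basis s)%R <= n.+1)%N.
  apply: leq_trans (size_sum _ _ _) _; apply/bigmax_leqP => s _.
  rewrite mul_polyC; apply: leq_trans (size_scale_leq _ _) _.
  by apply: leq_trans (IHn s (leq_ord s)).1 _; apply: ltn_ord.
rewrite norm_basisS; split; last by rewrite coefD [X in _ + X]nth_default ?addr0.
apply: leq_trans (size_polyD _ _) _; rewrite geq_max (shf.1 _).1.
exact: leq_trans lo _.
Qed.

Lemma norm_basis_shaped : shaped norm_basis.
Proof.
have [stf szf] := shf.
by split=> s; have [sz eq] := norm_basis_lead s; rewrite ?eq //; split=> //;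
  apply: (stf s).2.
Qed.

Lemma norm_diag_monic r : norm_diag r \is monic /\ size (norm_diag r) = (D r).+1.
Proof.
have [stf szf] := shf; rewrite /norm_diag (norm_basis_lead r).2.
have [] := rdivp_monic (stf r).2 (stf r.+1).2; first by rewrite !szf ltnS mu_mono.
by rewrite !szf => -> ->; rewrite subSS (mu_rec D_high r) addnK.
Qed.

Lemma size_norm_low r l : (size (norm_low r l) <= D r)%N.
Proof.
by have [mon sz] := norm_diag_monic r; rewrite -ltnS -sz ltn_rmodpN0 ?monic_neq0.
Qed.

Lemma diag_coef_norm_param r : diag_coef D norm_param r = norm_diag r.
Proof.
have [mon sz] := norm_diag_monic r; apply/polyP => i.
rewrite coefD coefXn coef_poly /norm_param eqxx; case: (ltngtP i (D r)) => iD.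
- by rewrite add0r.
- by rewrite addr0 nth_default // sz.
by move: mon; rewrite addr0 monicE lead_coefE sz iD => /eqP ->.
Qed.

Lemma low_coef_norm_param r l : (l <= r)%N -> low_coef D norm_param r l = norm_low r l.
Proof.
move=> lr; apply/polyP => i; rewrite coef_poly /norm_param ltn_eqF //.
by case: ltnP => // iD; rewrite nth_default // (leq_trans (size_norm_low r l)).
Qed.

End Ring.

Section Map.

Variables (K L : comNzRingType) (f : {rmorphism K -> L}) (a : nat -> {poly {poly K}}).
Hypothesis sha : shaped a.
Local Notation map1 := (map_poly f).
Local Notation map2 := (map_poly (map_poly f)).
Local Notation fa := (fun r => map2 (a r)).

Lemma map_shaped : shaped fa.
Proof.
have [st sz] := sha.
split=> s; rewrite coef_map /=; last first.
  rewrite size_map_poly_id0 // (monicP (st s).2) rmorph1; exact: oner_neq0.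
split; last by apply: monic_map; apply: (st s).2.
exact: leq_trans (size_poly _ _) (st s).1.
Qed.

Lemma map_norm_diag_rec r : map2 (norm_basis a r) = norm_basis fa r ->
  map1 (norm_diag a r) = norm_diag fa r.
Proof.
by move=> e; rewrite /norm_diag -e !coef_map /= map_rdivp //; apply: (sha.1 _).2.
Qed.

Lemma map_norm_quo_rec r l : (forall s, (s <= r)%N ->
  map2 (norm_basis a s) = norm_basis fa s) ->
  map1 (norm_quo a r l) = norm_quo fa r l.
Proof.
move=> e; rewrite /norm_quo map_stair_quo => [|i _];
  last exact: ((norm_basis_shaped sha).1 i).2.
rewrite rmorphB !rmorphM /= map_polyX map_polyC /= map_norm_diag_rec ?e //.
by apply: eq_stair_quo => i ir; rewrite e.
Qed.

Lemma map_norm_basis r : map2 (norm_basis a r) = norm_basis fa r.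
Proof.
elim: r {-2}r (leqnn r) => [|n IHn] r.
  by rewrite leqn0 => /eqP ->; rewrite norm_basis0.
rewrite leq_eqVlt => /predU1P[->|]; last exact: IHn.
rewrite !norm_basisS rmorphD rmorph_sum /=; congr (_ + _); apply: eq_bigr => s _.
rewrite rmorphM /= map_polyC IHn ?leq_ord //=; congr (_%:P * _).
rewrite map_rdivp ?(norm_diag_monic sha _).1 // map_norm_quo_rec ?map_norm_diag_rec
  ?IHn //.
Qed.

(** The normalization uses only divisions by monic polynomials, so it commutes
    with every morphism of coefficient rings. *)
Lemma map_norm_param r l p : f (norm_param a r l p) = norm_param fa r l p.
Proof.
have e := map_norm_basis; rewrite /norm_param; case: eqP => _; rewrite -coef_map /=.
  by rewrite map_norm_diag_rec.
by rewrite /norm_low map_rmodp ?(norm_diag_monic sha _).1 // map_norm_diag_rec //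
  map_norm_quo_rec.
Qed.

End Map.

Section Field.

Variable k : fieldType.
Local Notation P2 := {poly {poly k}}.
Variables (J : P2 -> Prop) (f : nat -> P2).
Hypotheses (lJ : lead_ideal t D J) (shf : shaped f) (Jf : forall r, J (f r)).

Lemma norm_basis_in r : J (norm_basis f r).
Proof.
elim: r {-2}r (leqnn r) => [|n IHn] r.
  by rewrite leqn0 => /eqP ->; rewrite norm_basis0.
rewrite leq_eqVlt => /predU1P[->|]; last exact: IHn.
rewrite norm_basisS; apply: (leadD lJ) => //.
by apply: (lead_sum (fun s => (rdivp (norm_quo f n s) (norm_diag f n))%:P) lJ) => s;
  apply: IHn.
Qed.

(** The remainder of g_r modulo g_(r+1) is the coefficient of x^(r+1) of an
    element of [J], and it is too small to be nonzero. *)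
Lemma norm_diag_lead r : norm_diag f r * (f r.+1)`_r.+1 = (f r)`_r /\
  (size ('X * norm_basis f r - (norm_diag f r)%:P * f r.+1)%R <= r.+1)%N.
Proof.
set p := _ - _; have [stf szf] := shf.
have sp : (size p <= r.+2)%N.
  apply: leq_trans (size_polyD _ _) _; rewrite size_polyN geq_max.
  apply/andP; split.
    apply: leq_trans (size_polyMleq _ _) _; rewrite size_polyX /=.
    by rewrite ltnS (norm_basis_lead shf r).1.
  rewrite mul_polyC; apply: leq_trans (size_scale_leq _ _) (stf _).1.
have pr : p`_r.+1 = rmodp (f r)`_r (f r.+1)`_r.+1.
  rewrite coefB coefXM coefCM /= (norm_basis_lead shf r).2 /norm_diag
    (norm_basis_lead shf r).2.
  by rewrite {1}(rdivp_eq (stf r.+1).2 (f r)`_r) addrAC subrr add0r.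
have Jp : J p by apply: (leadB lJ); apply: (leadM lJ) => //; apply: norm_basis_in.
have p0 : p`_r.+1 = 0.
  apply: (lead_min lJ Jp) => //; rewrite pr -ltnS -szf.
  by rewrite ltn_rmodpN0 ?monic_neq0 ?(stf _).2.
split; last first.
  apply/leq_sizeP => j; rewrite leq_eqVlt => /predU1P[<- //|lt].
  by rewrite nth_default // (leq_trans sp).
rewrite [RHS](rdivp_eq (stf r.+1).2 (f r)`_r) -pr p0 addr0.
by rewrite /norm_diag (norm_basis_lead shf r).2.
Qed.

(** Membership in [J] makes the division exact. *)
Lemma norm_basis_relations : relations (norm_diag f) (norm_low f) (norm_basis f).
Proof.
move=> r; have [_ sz] := norm_diag_lead r.
have J1 : J ('X * norm_basis f r - (norm_diag f r)%:P * f r.+1).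
  by apply: (leadB lJ); apply: (leadM lJ) => //; apply: norm_basis_in.
have /eqP := lead_ideal_rem0 lJ (norm_basis_shaped shf) (fun s _ =>
  norm_basis_in s) J1 sz.
rewrite subr_eq0 => /eqP e; rewrite norm_basisS mulrDr.
have -> : (norm_diag f r)%:P * f r.+1 =
  'X * norm_basis f r - ('X * norm_basis f r - (norm_diag f r)%:P * f r.+1).
  by ring.
rewrite e -addrA; congr (_ + _); rewrite big_distrr /= -!sumrN -big_split /=.
apply: eq_bigr => l _; rewrite -/(norm_quo f r).
rewrite {1}(rdivp_eq (norm_diag_monic shf r).1 (norm_quo f r l)) -/(norm_low f r l)
  polyCD polyCM.
by ring.
Qed.

(** The leading coefficients multiply up along C_r, starting from column [t], where
    the height is zero and the leading coefficient is 1. *)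
Lemma norm_basis_lead_prod r : (norm_basis f r)`_r =
  lead_prod t (diag_coef D (norm_param f)) r.
Proof.
have [stf szf] := shf; rewrite (norm_basis_lead shf r).2.
case: (ltnP r t) => [rt|tr]; last first.
  rewrite lead_prod_high //; have [_ mon] := stf r; have := szf r; rewrite mu_high //.
  move=> sz; rewrite [LHS]size1_polyC ?sz //; move: mon.
  by rewrite monicE lead_coefE sz => /eqP ->.
have [n rn] := ubnP (t - r)%N; elim: n r rn {rt} => // n IHn r rn.
rewrite lead_prod_rec => [|q tq]; last exact: (diag_coef_high D_high).
rewrite -(norm_diag_lead r).1 diag_coef_norm_param //; congr (_ * _).
case: (ltnP r t) => [rt|tr]; first by apply: IHn; lia.
rewrite lead_prod_high ?(leqW tr) //; have [_ mon] := stf r.+1; have := szf r.+1.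
rewrite mu_high ?(leqW tr) // => sz; rewrite [LHS]size1_polyC ?sz //; move: mon.
by rewrite monicE lead_coefE sz => /eqP ->.
Qed.

(** The relations determine the basis from its leading coefficients, because
    multiplication by the monic C_n is injective. *)
Lemma stair_basis_norm_param r : stair_basis t D (norm_param f) r = norm_basis f r.
Proof.
elim: r {-2}r (leqnn r) => [|n IHn] r.
  rewrite leqn0 => /eqP ->;
    rewrite /stair_basis monic_part0 mulr1 -norm_basis_lead_prod -size1_polyC //.
  exact: (norm_basis_lead shf 0).1.
rewrite leq_eqVlt => /predU1P[->|]; last exact: IHn.
have mon : (norm_diag f n)%:P != 0 by rewrite polyC_eq0 monic_neq0 ?(norm_diag_monic
  shf n).1.
apply: (mulfI mon); rewrite norm_basis_relations -{1}diag_coef_norm_param //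
  stair_basis_relations // IHn //.
congr (_ - _); apply: eq_bigr => l _.
by rewrite low_coef_norm_param ?leq_ord // IHn ?leq_ord.
Qed.

Lemma lead_ideal_norm_param p : J p <-> span_ideal t D (norm_param f) p.
Proof.
apply: (lead_ideal_span p lJ (stair_basis_shaped t D _)) => s.
by rewrite stair_basis_norm_param; apply: norm_basis_in.
Qed.

End Field.

End Normalization.

(** * Bivariate polynomials as polynomials in x over k[y] *)

Local Notation mon := 'X_{1..2}.

Definition xdeg (m : mon) : nat := m ord0.
Definition ydeg (m : mon) : nat := m (@ord_max 1).
Definition bimon i j : mon := [multinom (if q == ord0 then i else j) | q < 2].

Lemma xdeg_bimon i j : xdeg (bimon i j) = i.
Proof. by rewrite /xdeg /bimon mnmE. Qed.

Lemma ydeg_bimon i j : ydeg (bimon i j) = j.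
Proof. by rewrite /ydeg /bimon mnmE. Qed.

Lemma mon_ext (m n : mon) : xdeg m = xdeg n -> ydeg m = ydeg n -> m = n.
Proof.
move=> ex ey; apply/mnmP => i; case: (unliftP ord0 i) => [j|] -> //.
by rewrite (ord1 j) (_ : lift _ _ = ord_max) //; apply: val_inj.
Qed.

Lemma bimonK m : bimon (xdeg m) (ydeg m) = m.
Proof. by apply: mon_ext; rewrite ?xdeg_bimon ?ydeg_bimon. Qed.

Lemma bimon_inj i j i' j' : (bimon i j == bimon i' j') = (i == i') && (j == j').
Proof.
apply/eqP/andP => [e|[/eqP -> /eqP ->] //].
by rewrite -(xdeg_bimon i j) e xdeg_bimon -(ydeg_bimon i j) e ydeg_bimon.
Qed.

Lemma lepm_deg (m n : mon) : (m <= n)%MM = (xdeg m <= xdeg n)%N && (ydeg m <= ydeg n)%N.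
Proof.
apply/mnm_lepP/andP => [le|[lx ly] i]; first by split; apply: le.
case: (unliftP ord0 i) => [j|] -> //.
by rewrite (ord1 j) (_ : lift _ _ = ord_max) //; apply: val_inj.
Qed.

Lemma mdeg_xy (m : mon) : mdeg m = (xdeg m + ydeg m)%N.
Proof.
rewrite mdegE big_ord_recl big_ord1; congr (_ + _)%N.
by rewrite (_ : lift _ _ = ord_max) //; apply: val_inj.
Qed.

Section Bridge.

Variable k : fieldType.
Local Notation R := {mpoly k[2]}.
Local Notation P2 := {poly {poly k}}.

Definition phi_var (i : 'I_2) : P2 := if i == ord0 then 'X else 'X%:P.
(** The ring isomorphism from k[x, y] to k[y][x]. *)
Definition phi (f : R) : P2 := mmap (polyC \o polyC) phi_var f.

HB.instance Definition _ := GRing.RMorphism.copy phi (mmap (polyC \o polyC) phi_var).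

Lemma phiB f g : phi (f - g) = phi f - phi g.
Proof. exact: raddfB. Qed.

Lemma phi_sum (I : Type) (r : seq I) (P : pred I) (G : I -> R) :
  phi (\sum_(i <- r | P i) G i) = \sum_(i <- r | P i) phi (G i).
Proof. exact: raddf_sum. Qed.

Lemma phi_mon m : phi 'X_[m] = 'X^(xdeg m) * ('X^(ydeg m))%:P.
Proof.
rewrite /phi mmapX /mmap1 big_ord_recl big_ord1 /phi_var /=; congr (_ * _).
by rewrite rmorphXn /= (_ : lift _ _ = ord_max) //; apply: val_inj.
Qed.

Lemma coef_phi f i j : (phi f)`_i`_j = f@_(bimon i j).
Proof.
rewrite {2}(mpolyE f) {1}(mpolyE f) !raddf_sum /= !coef_sum.
apply: eq_bigr => m _; rewrite -mul_mpolyC rmorphM /= phi_mon.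
rewrite mcoeffCM mcoeffX [phi _%:MP]mmapC /= !coefCM; congr (_ * _).
rewrite coefMC coefXn mulr_natl coefMn coefXn -{3}(bimonK m) bimon_inj.
by rewrite ![_ == xdeg m]eq_sym ![_ == ydeg m]eq_sym; do 2 case: eqP.
Qed.

Lemma phi_inj : injective phi.
Proof.
move=> f g e; apply/mpolyP => m; rewrite -(bimonK m).
by rewrite -!coef_phi e.
Qed.

Lemma phi_surj p : exists f, phi f = p.
Proof.
have C (c : {poly k}) : exists f, phi f = c%:P.
  elim/poly_ind: c => [|c a [f e]]; first by exists 0; rewrite rmorph0.
  exists (f * 'X_(@ord_max 1) + a%:MP).
  rewrite rmorphD rmorphM /= e {2}/phi mmapC /= polyCD polyCM; congr (_ * _ + _).
  by rewrite /phi /= mmapX mmap1U.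
elim/poly_ind: p => [|p c [f e]]; first by exists 0; rewrite rmorph0.
have [g eg] := C c; exists (f * 'X_ord0 + g).
by rewrite rmorphD rmorphM /= e eg; congr (_ * _ + _); rewrite /phi mmapX mmap1U.
Qed.

Lemma phi_x : phi (varx k) = 'X.
Proof. by rewrite /varx /phi mmapX mmap1U. Qed.

Lemma phi_y : phi (vary k) = 'X%:P.
Proof. by rewrite /vary /phi mmapX mmap1U. Qed.

(** In the lexicographic order with x > y, the leading monomial is read off the
    x-degree and the y-degree of the coefficient of the highest power of x. *)
Lemma is_LtP f m : is_Lt f m <->
  size (phi f) = (xdeg m).+1 /\ size ((phi f)`_(xdeg m))%R = (ydeg m).+1.
Proof.
split=> [[mf lt]|[sx sy]].
  have lo i j : bimon i j != m -> ~~ lexlt (bimon i j) m -> (phi f)`_i`_j = 0.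
    move=> ne nl; rewrite coef_phi memN_msupp_eq0 //; apply/negP => h.
    by move: nl; rewrite lt.
  have fm : (phi f)`_(xdeg m)`_(ydeg m) != 0.
    by rewrite coef_phi bimonK -mcoeff_msupp.
  have sz (K : nzSemiRingType) (q : {poly K}) n : q`_n != 0 ->
      (forall j, (n < j)%N -> q`_j = 0) -> size q = n.+1.
    move=> qn hi; apply/eqP; rewrite eqn_leq; apply/andP; split.
      exact/leq_sizeP.
    by rewrite ltnNge; apply: contra qn => le; rewrite nth_default.
  split; apply: sz => //.
  - by apply: contra fm => /eqP ->; rewrite coef0.
  - move=> i mi; apply/polyP => j; rewrite coef0; apply: lo.
      by apply: contraTneq mi => <-; rewrite xdeg_bimon ltnn.
    rewrite /lexlt -!/(xdeg _) -!/(ydeg _) xdeg_bimon ydeg_bimon.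
    by rewrite ltnNge (ltnW mi) gtn_eqF.
  move=> j mj; apply: lo.
    by apply: contraTneq mj => <-; rewrite ydeg_bimon ltnn.
  rewrite /lexlt -!/(xdeg _) -!/(ydeg _) xdeg_bimon ydeg_bimon.
  by rewrite ltnn eqxx /= -leqNgt ltnW.
have nz : (phi f)`_(xdeg m)`_(ydeg m) != 0.
  rewrite -[X in _`_X]/(ydeg m).+1.-1 -sy -lead_coefE lead_coef_eq0.
  by rewrite -size_poly_eq0 sy.
split=> [|n n_f nm]; first by rewrite mcoeff_msupp -(bimonK m) -coef_phi.
move: n_f; rewrite mcoeff_msupp -(bimonK n) -coef_phi => n_f.
rewrite /lexlt -!/(xdeg _) -!/(ydeg _) xdeg_bimon ydeg_bimon.
have xle : (xdeg n <= xdeg m)%N.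
  rewrite -ltnS -sx ltnNge; apply: contra n_f => le.
  by rewrite (nth_default 0 le) coef0.
case: ltngtP xle => //= ex _.
have yle : (ydeg n <= ydeg m)%N.
  rewrite -ltnS -sy ltnNge; apply: contra n_f => le; rewrite ex.
  by rewrite (nth_default 0 le).
rewrite ltn_neqAle yle andbT; apply: contra nm => /eqP ey.
by apply/eqP/mon_ext.
Qed.

Definition push (I : R -> Prop) (p : P2) : Prop := exists2 f, I f & phi f = p.

Lemma push_phi I f : push I (phi f) <-> I f.
Proof. by split=> [[g Ig /phi_inj <-] //|If]; exists f. Qed.

Definition idealP2 (J : P2 -> Prop) : Prop :=
  [/\ J 0, forall p q, J p -> J q -> J (p + q) & forall p q, J q -> J (p * q)].

Lemma push_ideal I : is_ideal I -> idealP2 (push I).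
Proof.
case=> I0 ID IM; split.
- by exists 0; rewrite ?rmorph0.
- by move=> _ _ [f If <-] [g Ig <-]; exists (f + g); rewrite ?rmorphD //; apply: ID.
move=> p _ [g Ig <-]; have [f <-] := phi_surj p.
by exists (f * g); rewrite ?rmorphM //; apply: IM.
Qed.

Lemma pull_ideal J : idealP2 J -> is_ideal (fun f => J (phi f)).
Proof.
case=> J0 JD JM; split.
- by rewrite rmorph0.
- by move=> f g; rewrite rmorphD; apply: JD.
by move=> f g; rewrite rmorphM; apply: JM.
Qed.

(** The polynomials all of whose monomials are multiples of members of [A] form an
    ideal. *)
Lemma monomial_genP (A : mon -> Prop) f :
  ideal_gen (fun g : R => exists2 m, A m & g = 'X_[m]) f <->
  forall m, m \in msupp f -> exists2 a, A a & (a <= m)%MM.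
Proof.
split=> [gf|sup J [J0 JD JM] gen].
  apply: (gf (fun f => forall m, m \in msupp f -> exists2 a, A a & (a <= m)%MM));
    last first.
    by move=> _ [a Aa ->] m; rewrite msuppX inE => /eqP ->; exists a;
      rewrite ?lepm_refl.
  split=> [m|g h Jg Jh m /msuppD_le|g h Jh m /msuppM_le].
  - by rewrite msupp0.
  - by rewrite mem_cat => /orP[/Jg|/Jh].
  case/allpairsP => -[m1 m2] /= [_ /Jh[a Aa le] ->]; exists a => //.
  apply: lepm_trans le _; exact: lem_addl.
rewrite (mpolyE f) big_seq; elim/big_rec: _ => [|m g mf Jg]; first exact: J0.
apply: JD => //; have [a Aa le] := sup m mf.
by rewrite -mul_mpolyC; apply: (JM); rewrite -(submK le) mpolyXD; apply: (JM);
  apply: gen; exists a.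
Qed.

Lemma Lt_idealP (S : R -> Prop) f : Lt_ideal S f <->
  forall m, m \in msupp f -> exists2 a, (exists2 g : R, S g & is_Lt g a) & (a <= m)%MM.
Proof.
rewrite -monomial_genP; split=> h J iJ gen; apply: h => // s.
  by case=> g [m [Sg lt ->]]; apply: gen; exists m => //; exists g.
by case=> m [g Sg lt] ->; apply: gen; exists g, m; split.
Qed.

Variables (t : nat) (D : nat -> nat) (E : R -> Prop).
Local Notation mu := (mu t D).
Hypothesis D_high : forall r, (t <= r)%N -> D r = 0%N.
Hypothesis EP : forall f, E f <-> forall m, m \in msupp f -> (mu (xdeg m) <= ydeg m)%N.

Lemma E_mon m : E 'X_[m] <-> (mu (xdeg m) <= ydeg m)%N.
Proof.
rewrite EP; split=> [h|h n]; first by apply: h; rewrite msuppX inE.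
by rewrite msuppX inE => /eqP ->.
Qed.

(** Multiplication by a monomial shifts the leading monomial. *)
Lemma shift_size (p : P2) i j a b : size p = a.+1 -> size (p`_a)%R = b.+1 ->
  size ('X^i * ('X^j)%:P * p)%R = (a + i).+1 /\
  size (('X^i * ('X^j)%:P * p)`_(a + i))%R = (b + j).+1.
Proof.
move=> sa sb.
have ja : ('X^j : {poly k}) != 0 by rewrite monic_neq0 ?monicXn.
have cp : size (('X^j)%:P * p)%R = a.+1.
  by rewrite mul_polyC size_scale.
have q0 : ('X^j)%:P * p != 0 by rewrite -size_poly_eq0 cp.
have pa0 : p`_a != 0 by rewrite -size_poly_eq0 sb.
split; first by rewrite -mulrA (mulrC 'X^i) size_mulXn // cp addnS addnC.
rewrite -mulrA coefXnM ltnNge leq_addl /= addnK coefCM mulrC.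
by rewrite size_mulXn // sb addnS addnC.
Qed.

(** Since the leading monomials of an ideal are closed under multiples, it is
    enough to realize the lowest monomial of E in each column. *)
Lemma V0_lead I : V0 E I <-> is_ideal I /\ lead_ideal t D (push I).
Proof.
split=> [[iI LE]|[iI lJ]].
  split=> //; have [J0 JD JM] := push_ideal iI; split=> //.
    move=> _ r [f If <-] sf mule; apply/eqP; apply: contraLR mule => nz;
      rewrite -ltnNge.
    have sf' : size (phi f) = r.+1.
      apply/eqP; rewrite eqn_leq sf ltnNge; apply: contra nz => le.
      by rewrite nth_default.
    pose m := bimon r (size ((phi f)`_r)%R).-1.
    have lt : is_Lt f m.
      apply/is_LtP; rewrite xdeg_bimon ydeg_bimon prednK //.
      by rewrite size_poly_gt0.
    have : E 'X_[m].
      apply/LE/Lt_idealP => n; rewrite msuppX inE => /eqP ->.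
      by exists m; [exists f|apply: lepm_refl].
    by rewrite E_mon xdeg_bimon ydeg_bimon -ltnS prednK // size_poly_gt0.
  move=> r; pose m := bimon r (mu r).
  have : E 'X_[m] by rewrite E_mon xdeg_bimon ydeg_bimon.
  move/LE/Lt_idealP/(_ m); rewrite msuppX inE eqxx => /(_ isT)[a [g Ig lt]].
  rewrite lepm_deg xdeg_bimon ydeg_bimon => /andP[ax ay].
  have [sx sy] := (is_LtP g a).1 lt.
  have := shift_size (r - xdeg a) (mu r - ydeg a) sx sy.
  rewrite !subnKC //; set p := _ * phi g => -[px py].
  have Jp : push I p by apply: JM; exists g.
  set c := lead_coef (p`_r)%R.
  have c0 : c != 0 by rewrite lead_coef_eq0 -size_poly_eq0 py.
  exists ((c^-1)%:P%:P * p); split; first exact: JM.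
  - by rewrite mul_polyC (leq_trans (size_scale_leq _ _)) ?px.
  - by rewrite coefCM monicE lead_coefM lead_coefC mulVf.
  by rewrite coefCM mul_polyC size_scale // invr_neq0.
split=> // f; rewrite Lt_idealP EP; split=> h m /h.
  case=> a [g Ig lt]; rewrite lepm_deg => /andP[ax ay].
  have [sx sy] := (is_LtP g a).1 lt.
  apply: leq_trans (mu_mono D_high ax) _; apply: leq_trans ay.
  rewrite leqNgt; apply/negP => le; have Jg : push I (phi g) by exists g.
  have := lead_min lJ Jg (eq_leq sx).
  by rewrite sy => /(_ le) e; rewrite e size_poly0 in sy.
move=> le; have [_ [[g Ig <-] sp mp sm]] := lead_ex lJ (xdeg m).
exists (bimon (xdeg m) (mu (xdeg m))); last first.
  by rewrite lepm_deg xdeg_bimon ydeg_bimon leqnn.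
exists g => //; apply/is_LtP; rewrite xdeg_bimon ydeg_bimon sm; split=> //.
apply/eqP; rewrite eqn_leq sp ltnNge; apply/negP => le'.
by rewrite nth_default ?size_poly0 in sm.
Qed.

Definition param_ideal (a : nat -> nat -> nat -> k) (f : R) : Prop :=
  span_ideal t D a (phi f).

Lemma push_param_ideal a p : push (param_ideal a) p <-> span_ideal t D a p.
Proof.
split=> [[f If <-] //|]; by have [f <-] := phi_surj p => Jf; exists f.
Qed.

End Bridge.

(** * Reduced Groebner bases *)

Section NormalForm.

Variables (t : nat) (D : nat -> nat).

(** The normal form of x^i y^j modulo the ideal with parameters [a].  The divisors
    up to [F i] are enough, so the result has x-degree at most [i]. *)
Definition normal_form (K : comNzRingType) (a : nat -> nat -> nat -> K) (i j : nat) :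
    {poly {poly K}} :=
  stair_rem (stair_basis t D a) i.+1 ('X^i * ('X^j)%:P).

Lemma map_normal_form (K L : comNzRingType) (f : {rmorphism K -> L}) a i j :
  map_poly (map_poly f) (normal_form a i j) = normal_form (fun r l p =>
    f (a r l p)) i j.
Proof.
rewrite /normal_form map_stair_rem => [|s _];
  last exact: (stair_basis_staircase t D a s).2.
rewrite rmorphM /= map_polyXn map_polyC /= map_polyXn /stair_rem.
congr (_ - _); apply: eq_bigr => s _; rewrite map_stair_basis; congr (_%:P * _).
by apply: eq_stair_quo => l _; rewrite map_stair_basis.
Qed.

End NormalForm.

Section Groebner.

Variable k : fieldType.
Local Notation R := {mpoly k[2]}.
Local Notation P2 := {poly {poly k}}.
Local Notation mon := 'X_{1..2}.
Variables (t : nat) (D : nat -> nat) (E : R -> Prop).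
Local Notation mu := (mu t D).
Hypothesis D_high : forall r, (t <= r)%N -> D r = 0%N.
Hypothesis EP : forall f, E f <-> forall m, m \in msupp f -> (mu (xdeg m) <= ydeg m)%N.

(** The minimal generators of E sit on top of the first column and of the columns
    that are lower than the column on their left. *)
Definition is_gen (m : mon) : bool :=
  (ydeg m == mu (xdeg m)) && ((xdeg m == 0%N) || (0 < D (xdeg m).-1)%N).
Definition is_std (m : mon) : bool := (ydeg m < mu (xdeg m))%N.

Lemma is_stdP m : ~ E 'X_[m] <-> is_std m.
Proof. by rewrite (E_mon EP) /is_std ltnNge; split=> /negP. Qed.

Lemma min_genP m : min_gen E m <-> is_gen m.
Proof.
rewrite /min_gen (E_mon EP); split=> [[Em mm]|/andP[/eqP ym xm]].
  have ym : ydeg m = mu (xdeg m).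
    have := mm (bimon (xdeg m) (mu (xdeg m))).
    rewrite (E_mon EP) lepm_deg !xdeg_bimon !ydeg_bimon !leqnn Em => /(_ isT isT) <-.
    by rewrite ydeg_bimon xdeg_bimon.
  rewrite /is_gen ym eqxx /=; case x0 : (xdeg m) => [//|x] /=; rewrite lt0n;
    apply/negP => /eqP Dx.
  have := mm (bimon x (mu x)).
  rewrite (E_mon EP) lepm_deg !xdeg_bimon !ydeg_bimon leqnn x0 leqnSn /= ym x0.
  rewrite (mu_rec D_high x) Dx add0n leqnn => /(_ isT isT) e.
  by have := xdeg_bimon x (mu x.+1); rewrite e x0; lia.
split=> [|n]; first by rewrite ym.
rewrite (E_mon EP) lepm_deg => En /andP[xn yn].
have e : xdeg n = xdeg m.
  apply/eqP; rewrite eqn_leq xn leqNgt; apply/negP => lt.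
  case/orP: xm => [/eqP x0|Dx]; first by rewrite x0 in lt.
  have := mu_mono D_high (_ : (xdeg n <= (xdeg m).-1)%N); rewrite mu_rec // prednK;
    last by lia.
  by move=> /(_ ltac:(lia)); lia.
by apply: mon_ext => //; apply/eqP; rewrite eqn_leq yn ym -e.
Qed.

(** The leftmost column whose height does not exceed the y-degree of [m] carries
    such a generator. *)
Lemma gen_below m : E 'X_[m] -> exists2 n, min_gen E n & (n <= m)%MM.
Proof.
rewrite (E_mon EP) => Em.
have ex : exists x, (mu x <= ydeg m)%N by exists (xdeg m).
case: (ex_minnP ex) => x mx xmin; exists (bimon x (mu x)); last first.
  by rewrite lepm_deg xdeg_bimon ydeg_bimon mx xmin.
apply/min_genP; rewrite /is_gen xdeg_bimon ydeg_bimon eqxx /=.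
case: x mx xmin => // x mx xmin /=; rewrite lt0n; apply/negP => /eqP Dx.
by have := xmin x; rewrite mu_rec // Dx add0n mx => /(_ isT); rewrite ltnn.
Qed.

Lemma xdeg_gen m : is_gen m -> (xdeg m <= t)%N.
Proof.
case/andP=> _ /orP[/eqP -> //|]; case: (leqP (xdeg m) t) => // tx.
by rewrite D_high //; lia.
Qed.

Lemma coef_index_exists : exists N (c : N.-tuple (mon * mon)), coef_index E c.
Proof.
pose box := [seq bimon i j | i <- iota 0 t.+1, j <- iota 0 (mu 0).+1].
pose l := undup [seq p <- [seq (m, m') | m <- box, m' <- box] |
  [&& is_gen p.1, is_std p.2 & lexlt p.2 p.1]].
have boxP m : (xdeg m <= t)%N -> (ydeg m <= mu 0)%N -> m \in box.
  move=> xm ym; rewrite -(bimonK m); apply: allpairs_f; rewrite mem_iota; lia.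
exists (size l), (in_tuple l); split=> [|m m']; first exact: undup_uniq.
rewrite mem_undup mem_filter.
split=> [/andP[/and3P[gm sm' lt] _]|[/min_genP gm /is_stdP sm' lt]].
  by split=> //; [apply/min_genP|apply/is_stdP].
rewrite [X in X && _]/= gm sm' lt andTb.
have mx i : (mu i <= mu 0)%N by apply: mu_mono.
apply/allpairsP; exists (m, m'); split=> //=; apply: boxP.
- exact: xdeg_gen.
- by case/andP: gm => /eqP ->.
- by case: (leqP (xdeg m') t) => // /ltnW tx; move: sm'; rewrite /is_std mu_high.
exact: leq_trans (ltnW sm') _.
Qed.

Variables (N : nat) (c : N.-tuple (mon * mon)).
Hypothesis cP : coef_index E c.

Lemma lexlt_irr m : lexlt m m = false.
Proof. by rewrite /lexlt !ltnn andbF. Qed.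

Lemma mcoeff_groebner_poly (lam : 'rV[k]_N) m q :
  (groebner_poly c lam m)@_q =
    (m == q)%:R - \sum_(i < N | tnth c i == (m, q)) lam 0 i.
Proof.
rewrite mcoeffB mcoeffX raddf_sum /=; congr (_ - _).
rewrite [RHS](eq_bigl (fun i => ((tnth c i).1 == m) && ((tnth c i).2 == q)));
  last first.
  by move=> i; rewrite -pair_eqE; case: (tnth c i).
rewrite [RHS]big_mkcondr /=; apply: eq_bigr => i _.
by rewrite mcoeffZ mcoeffX; case: eqP => _; rewrite ?mulr1 ?mulr0.
Qed.

Lemma mcoeff_groebner_in (lam : 'rV[k]_N) i m q : tnth c i = (m, q) ->
  (groebner_poly c lam m)@_q = - lam 0 i.
Proof.
move=> ci; rewrite mcoeff_groebner_poly (big_pred1 i) => [|j /=].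
  have : (m, q) \in c by rewrite -ci mem_tnth.
  case/(cP.2 m q) => _ _; case: eqP => [->|_ _]; first by rewrite lexlt_irr.
  by rewrite sub0r.
have /tuple_uniqP inj := cP.1.
by apply/eqP/eqP => [|->] //; rewrite -ci => /inj.
Qed.

Lemma mcoeff_groebner_out (lam : 'rV[k]_N) m q : (m, q) \notin c ->
  (groebner_poly c lam m)@_q = (m == q)%:R.
Proof.
move=> nc; rewrite mcoeff_groebner_poly big_pred0 ?subr0 // => i.
by apply: contraNF nc => /eqP <-; apply: mem_tnth.
Qed.

Variable a : nat -> nat -> nat -> k.
Local Notation nfa m := (normal_form t D a (xdeg m) (ydeg m)).
Local Notation Ia := (param_ideal t D a).

Lemma normal_form_std m s : (size ((nfa m)`_s)%R <= mu s)%N.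
Proof.
have stF := stair_basis_staircase t D a.
case: (ltnP s (xdeg m).+1) => sm.
  by rewrite -ltnS -(stair_basis_shaped t D a).2 stair_rem_small.
rewrite nth_default ?size_poly0 //; apply: leq_trans sm; apply: stair_rem_size => //.
rewrite mulrC mul_polyC; apply: leq_trans (size_scale_leq _ _) _.
by rewrite size_polyXn.
Qed.

Lemma normal_form_size m : (size (nfa m) <= (xdeg m).+1)%N.
Proof.
apply: stair_rem_size; first exact: stair_basis_staircase.
rewrite mulrC mul_polyC; apply: leq_trans (size_scale_leq _ _) _.
by rewrite size_polyXn.
Qed.

Lemma normal_form_in m : span_ideal t D a (phi 'X_[m] - nfa m).
Proof.
rewrite phi_mon /normal_form /stair_rem opprB addrCA subrr addr0.
by exists (xdeg m).+1, (stair_quo (stair_basis t D a) (xdeg m).+1 ('X^(xdeg m) *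
  ('X^(ydeg m))%:P)).
Qed.

Definition normal_form_coef (p : mon * mon) : k := (nfa p.1)`_(xdeg p.2)`_(ydeg p.2).

Lemma groebner_normal_form (lam : 'rV[k]_N) m : min_gen E m ->
  (forall i, lam 0 i = normal_form_coef (tnth c i)) ->
  phi (groebner_poly c lam m) = phi 'X_[m] - nfa m.
Proof.
move=> gm lamE; apply/polyP => i; apply/polyP => j.
rewrite coefB coefB !coef_phi mcoeffX; case: (boolP ((m, bimon i j) \in c)) => mc.
  have /tnthP[l ml] := mc.
  rewrite (mcoeff_groebner_in _ (esym ml)) lamE -ml /normal_form_coef /= xdeg_bimon
    ydeg_bimon.
  have [_ _] := (cP.2 _ _).1 mc; case: eqP => [<-|_ _]; first by rewrite lexlt_irr.
  by rewrite sub0r.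
rewrite mcoeff_groebner_out // -[LHS]subr0; congr (_ - _); apply/esym/eqP.
apply: contraR mc => nz.
have ij : (j < mu i)%N.
  rewrite ltnNge; apply: contra nz => le; rewrite nth_default //.
  exact: leq_trans (normal_form_std m i) le.
have im : (i < (xdeg m).+1)%N.
  rewrite ltnNge; apply: contra nz => le;
    rewrite (nth_default 0 (s := nfa m)) ?coef0 //.
  exact: leq_trans (normal_form_size m) le.
apply/cP.2; split=> //; first by apply/is_stdP; rewrite /is_std xdeg_bimon ydeg_bimon.
rewrite /lexlt -!/(xdeg _) -!/(ydeg _) xdeg_bimon ydeg_bimon.
move: im; rewrite ltnS leq_eqVlt => /predU1P[im|->] //; rewrite im eqxx ltnn /=.
by have /andP[/eqP -> _] := (min_genP m).1 gm; rewrite -im.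
Qed.

Lemma param_ideal_V0 : V0 E Ia.
Proof.
have lJ := span_ideal_lead_ideal D_high a.
apply/(V0_lead D_high EP); split.
  by apply: pull_ideal; split; [exact: lead0 lJ|exact: leadD lJ|exact: leadM lJ].
have e p : push Ia p <-> span_ideal t D a p by apply: push_param_ideal.
split.
- by apply/e; apply: lead0 lJ.
- by move=> p q /e Jp /e Jq; apply/e; apply: leadD lJ _ _ Jp Jq.
- by move=> p q /e Jq; apply/e; apply: leadM lJ _ _ Jq.
- by move=> p r /e Jp; apply: (lead_min lJ Jp).
by move=> r; have [p [/e Jp *]] := lead_ex lJ r; exists p.
Qed.

Lemma is_Lt_uniq (f : R) m n : is_Lt f m -> is_Lt f n -> m = n.
Proof.
move=> /is_LtP[sx sy] /is_LtP[sx' sy'].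
have ex : xdeg m = xdeg n by move: sx'; rewrite sx => -[].
by apply: mon_ext => //; move: sy'; rewrite -ex sy => -[].
Qed.

(** If the polynomials f_m form a reduced Groebner basis of the ideal, then m - f_m
    is congruent to m and lies below the staircase, so it is the normal form of m;
    conversely the normal forms define polynomials f_m as required. *)
Lemma coef_vectorP (lam : 'rV[k]_N) :
  coef_vector E c Ia lam <-> forall i, lam 0 i = normal_form_coef (tnth c i).
Proof.
split=> [[gen _ _] i|lamE].
  case ci : (tnth c i) => [m q].
  have mq : (m, q) \in c by rewrite -ci mem_tnth.
  have [gm sq lq] := (cP.2 _ _).1 mq.
  have If : Ia (groebner_poly c lam m) by apply: (proj1 (gen _ _)); exists m.
  set g := groebner_poly c lam m in If.
  have lJ := span_ideal_lead_ideal D_high a.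
  have Id : span_ideal t D a (nfa m - (phi 'X_[m] - phi g)).
    have -> : nfa m - (phi 'X_[m] - phi g) = phi g - (phi 'X_[m] - nfa m) by ring.
    exact: leadB lJ If (normal_form_in m).
  have d0 : nfa m - (phi 'X_[m] - phi g) = 0.
    apply: (std_eq0 lJ Id) => s; rewrite coefB.
    apply: leq_trans (size_polyD _ _) _; rewrite size_polyN geq_max normal_form_std /=.
    apply/leq_sizeP => j sj;
      rewrite !coefB !coef_phi mcoeffX mcoeff_groebner_out ?subrr //.
    apply/negP => /cP.2[_ /is_stdP + _]; rewrite /is_std xdeg_bimon ydeg_bimon; lia.
  rewrite /normal_form_coef /=; move: (nfa m) d0 => u /subr0_eq ->.
  rewrite 2!coefB !coef_phi bimonK mcoeffX (mcoeff_groebner_in _ ci).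
  by case: eqP lq => [->|_ _]; rewrite ?lexlt_irr // sub0r opprK.
have Lt m : min_gen E m -> is_Lt (groebner_poly c lam m) m.
  move=> gm; split=> [|n].
    rewrite mcoeff_msupp mcoeff_groebner_out ?eqxx ?oner_neq0 //.
    by apply/negP => /cP.2[_ _]; rewrite lexlt_irr.
  rewrite mcoeff_msupp; case: (boolP ((m, n) \in c)) => [/cP.2[] //|nc].
  by rewrite mcoeff_groebner_out // => + nm; rewrite (eq_sym m) (negPf nm) eqxx.
have In m : min_gen E m -> Ia (groebner_poly c lam m).
  by move=> gm; rewrite /param_ideal (groebner_normal_form gm lamE);
    apply: normal_form_in.
split.
- move=> _ [m gm ->]; split; first exact: In.
  exists m; first exact: Lt.
  rewrite mcoeff_groebner_out ?eqxx //.
  by apply/negP => /cP.2[_ _]; rewrite lexlt_irr.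
- move=> f; split.
    rewrite !Lt_idealP => h m /h[b [_ [n gn ->] lt] le]; exists b => //.
    by exists (groebner_poly c lam n) => //; apply: In.
  move/(proj2 param_ideal_V0)/EP => Ef; apply/Lt_idealP => m /Ef;
    rewrite -(E_mon EP) => /gen_below[n gn nm].
  by exists n => //; exists (groebner_poly c lam n); [exists n|apply: Lt].
move=> _ _ p q [m gm ->] [n gn ->] ne pm ltq.
rewrite -(is_Lt_uniq (Lt n gn) ltq) {q ltq}; apply/negP => np.
have nm : n <> m by move=> e; apply: ne; rewrite e.
case: (eqVneq p m) => pm'; first by apply: nm; apply: gm.2 gn.1 _; rewrite -pm'.
move: pm; rewrite mcoeff_msupp; case: (boolP ((m, p) \in c)) => [/cP.2[_ Ep _] _|nc].
  apply: Ep; rewrite (E_mon EP); have := gn.1; rewrite (E_mon EP) => En.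
  move: np; rewrite lepm_deg => /andP[nx ny].
  by apply: leq_trans (mu_mono D_high nx) _; apply: leq_trans ny.
by rewrite mcoeff_groebner_out // (eq_sym m) (negPf pm') eqxx.
Qed.

End Groebner.

(** * Nilpotency of y and of x *)

Section Subfamilies.

Variable k : fieldType.
Local Notation R := {mpoly k[2]}.
Local Notation P2 := {poly {poly k}}.
Variables (t : nat) (D : nat -> nat) (E : R -> Prop).
Local Notation mu := (mu t D).
Hypothesis D_high : forall r, (t <= r)%N -> D r = 0%N.
Hypothesis EP : forall f, E f <-> forall m, m \in msupp f -> (mu (xdeg m) <= ydeg m)%N.

Variable a : nat -> nat -> nat -> k.
Local Notation F := (stair_basis t D a).
Local Notation J := (span_ideal t D a).

(** The only prime factor of a power of the variable is the variable. *)
Lemma monic_dvd_Xn (p : {poly k}) n : p \is monic -> p %| 'X^n -> p = 'X^((size p).-1).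
Proof.
move=> mon; rewrite -['X]subr0 -polyC0 => /dvdp_exp_XsubCP[j _].
rewrite polyC0 subr0 => e; have -> : size p = j.+1 by rewrite (eqp_size e) size_polyXn.
by apply/eqP; rewrite -eqp_monic ?monicXn.
Qed.

(** Every C_r is a power of y. *)
Definition diag_trivial : Prop := forall r p, (r < t)%N -> (p < D r)%N ->
  a r r.+1 p = 0.

Lemma diag_trivial_diag_coef r : diag_trivial -> diag_coef D a r = 'X^(D r).
Proof.
move=> c1; apply/polyP => i; rewrite coefD coef_poly; case: ltnP => iD;
  rewrite ?addr0 //.
by case: (ltnP r t) => rt; [rewrite c1 ?addr0|rewrite D_high in iD].
Qed.

Lemma diag_coef_diag_trivial : (forall r, (r < t)%N ->
  diag_coef D a r = 'X^(D r)) -> diag_trivial.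
Proof.
move=> h r p rt pD; have /polyP/(_ p) := h r rt.
by rewrite coefD coef_poly pD -[RHS]addr0 => /addrI.
Qed.

Lemma diag_trivial_lead_prod r : diag_trivial ->
  lead_prod t (diag_coef D a) r = 'X^(mu r).
Proof.
move=> c1; rewrite /lead_prod /mu; elim/big_rec2: _ => [|q n p _ ->];
  first by rewrite expr0.
by rewrite diag_trivial_diag_coef // exprD.
Qed.

(** The ideal meets k[y] in the multiples of the leading coefficient of [F 0],
    which is the product of all C_r. *)
Lemma span_ideal_const c : J c%:P <-> lead_prod t (diag_coef D a) 0 %| c.
Proof.
split=> [Jc|].
  have [|q] := span_lead (stair_basis_staircase t D a) Jc (r := 0);
    first exact: size_polyC_leq1.
  by rewrite coefC /= (stair_basis_lead t D a 0).2 => ->; rewrite dvdp_mull.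
case/dvdpP=> q ->; rewrite polyCM; apply: spanZ.
by have := span_gen F 0; rewrite /stair_basis monic_part0 mulr1.
Qed.

Lemma span_ideal_yn n : J ('X^n)%:P -> diag_trivial.
Proof.
move=> /span_ideal_const dv; apply: diag_coef_diag_trivial => r rt.
rewrite [LHS](@monic_dvd_Xn _ n) ?diag_coef_monic ?size_diag_coef //.
apply: dvdp_trans dv; rewrite /lead_prod big_mkord.
by rewrite (bigD1 (Ordinal rt)) //= dvdp_mulr.
Qed.

Lemma diag_trivial_yn : diag_trivial -> J ('X^(mu 0))%:P.
Proof. by move=> c1; apply/span_ideal_const; rewrite diag_trivial_lead_prod. Qed.

Lemma V1_cond : V1 E (param_ideal t D a) <-> diag_trivial.
Proof.
split=> [[_ [n]]|c1]; first by rewrite /param_ideal rmorphXn /= phi_y -polyC_exp;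
  apply: span_ideal_yn.
split; first exact: param_ideal_V0.
by exists (mu 0); rewrite /param_ideal rmorphXn /= phi_y -polyC_exp;
  apply: diag_trivial_yn.
Qed.

Hypothesis t_gt0 : (0 < t)%N.
Hypothesis mu_gt0 : forall r, (r < t)%N -> (0 < mu r)%N.

Local Notation ev0 := (map_poly (horner_eval (0 : k))).
Local Notation zrun l r := ((\sum_(l <= q < r) D q) == 0)%N.
(** H_r at y = 0.  If every C_q is a power of y, the products of the C_q in the
    recursion become 1 or 0 there, according to whether all the [D q] vanish. *)
Definition fiber (r : nat) : {poly k} := ev0 (monic_part D a r).

(** Let r run over the columns with [0 < D r]; the indices [l <= r] such that no
    column in [l, ..., r - 1] has a drop form the block of r.  At y = 0 the
    recursion multiplies H by a polynomial whose lower coefficients are, up to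
    sign, the numbers [a r l 0] for l in this block. *)
Definition nilpotent_params : Prop := diag_trivial /\
  forall r l, (r < t)%N -> (l <= r)%N -> (0 < D r)%N -> zrun l r -> a r l 0%N = 0.

Lemma ymod (p : P2) : exists q, p = 'X%:P * q + map_poly polyC (ev0 p).
Proof.
elim/poly_ind: p => [|p c [q e]]; first by exists 0; rewrite !raddf0 mulr0 addr0.
have [c' ec] : exists c' : {poly k}, c = 'X * c' + (c.[0])%:P.
  elim/poly_ind: c => [|c b _]; first by exists 0; rewrite mulr0 horner0 add0r.
  by exists c; rewrite hornerMXaddC mulr0 add0r mulrC.
exists (q * 'X + c'%:P);
  rewrite {1}e {1}ec !rmorphD !rmorphM /= !map_polyX !map_polyC /=.
rewrite /horner_eval /=; ring.
Qed.

Lemma fiber_monic r : fiber r \is monic /\ size (fiber r) = r.+1.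
Proof.
rewrite /fiber; have [sz mon] := monic_part_monic D a r; split; first exact: monic_map.
by rewrite size_map_poly_id0 // (monicP mon) rmorph1 oner_eq0.
Qed.

Lemma fiber0 : fiber 0%N = 1. Proof. by rewrite /fiber monic_part0 rmorph1. Qed.

Lemma diag_trivial_prod l r : diag_trivial ->
  \prod_(l <= q < r) diag_coef D a q = 'X^(\sum_(l <= q < r) D q).
Proof.
move=> c1; elim/big_rec2: _ => [|q n p _ ->]; first by rewrite expr0.
by rewrite diag_trivial_diag_coef // exprD.
Qed.

Lemma fiberS r : diag_trivial -> fiber r.+1 = 'X * fiber r -
  \sum_(l < r.+1) (if (0 < D r)%N && zrun l r then a r l 0%N else 0)%:P * fiber l.
Proof.
move=> c1; rewrite /fiber monic_partS rmorphB rmorphM /= map_polyX rmorph_sum;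
  congr (_ - _).
apply: eq_bigr => l _; rewrite rmorphM /= map_polyC /=; congr (_%:P * _).
rewrite /horner_eval hornerM diag_trivial_prod // hornerXn expr0n horner_coef0
  coef_poly.
by case: (0 < D r)%N; case: (\sum_(_ <= _ < _) _ == 0)%N => /=;
  rewrite ?mulr1 ?mulr0 ?mul0r.
Qed.

Lemma fiber_step0 r : diag_trivial -> D r = 0%N -> fiber r.+1 = 'X * fiber r.
Proof.
by move=> c1 Dr; rewrite fiberS // Dr big1 ?subr0 // => l _; rewrite mul0r.
Qed.

Lemma fiber_zrun s r : diag_trivial -> (s <= r)%N -> zrun s r ->
  fiber r = 'X^(r - s) * fiber s.
Proof.
move=> c1 /subnK <-; elim: (r - s)%N => [|n IHn] /=; first by rewrite subnn mul1r.
rewrite addSn big_nat_recr ?leq_addl //= addn_eq0 => /andP[z /eqP Dz].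
by rewrite fiber_step0 // IHn // !addnK mulrA -exprS -addSn addnK.
Qed.

Lemma nilpotent_params_fiber r : nilpotent_params -> (r <= t)%N -> fiber r = 'X^r.
Proof.
move=> [c1 c2]; elim: r {-2}r (leqnn r) => [|n IHn] r.
  by rewrite leqn0 => /eqP -> _; rewrite fiber0.
rewrite leq_eqVlt => /predU1P[->|]; last exact: IHn.
move=> nt; rewrite fiberS // IHn ?(ltnW nt) // -exprS big1 ?subr0 // => l _.
by case: ifP => [/andP[Dn z]|_]; rewrite ?c2 ?mul0r // leq_ord.
Qed.

(** Let s be the first index of the block that ends at m.  At y = 0, H_(m+1) is the
    product of H_s and of a monic polynomial whose lower coefficients are the
    opposites of the parameters of the block.  If it divides a power of x, so does
    H_s; then both are powers of x, comparing coefficients shows that the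
    parameters of the block vanish, and one continues with s. *)
Lemma fiber_nilpotent_params n r : diag_trivial -> fiber r %| 'X^n ->
  forall r' l, (r' < r)%N -> (l <= r')%N ->
  (0 < D r')%N -> zrun l r' -> a r' l 0%N = 0.
Proof.
move=> c1; elim: r {-2}r (leqnn r) => [|m IHm] r.
  by rewrite leqn0 => /eqP ->.
rewrite leq_eqVlt => /predU1P[->|]; last exact: IHm.
case: (posnP (D m)) => [D0|Dm] dv r' l.
  rewrite ltnS leq_eqVlt => /predU1P[->|rm]; first by rewrite D0.
  apply: (IHm m) => //; apply: dvdp_trans dv.
  by rewrite fiber_step0 // dvdp_mull.
have ex : exists s, zrun s m by exists m; rewrite big_geq.
(* The block that ends at m starts at s. *)
case: (ex_minnP ex) => s zs smin.
have sm : (s <= m)%N by apply: smin; rewrite big_geq.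
have zl i : (s <= i)%N -> (i <= m)%N -> zrun s i /\ zrun i m.
  move=> si im; move: zs; rewrite (big_cat_nat si im) /= addn_eq0.
  by move=> /andP[].
have hl i : (s <= i)%N -> (i <= m)%N -> fiber i = 'X^(i - s) * fiber s.
  by move=> si im; apply: fiber_zrun => //; have [] := zl i si im.
have term (i : nat) : (i <= m)%N ->
    fiber s %| (if (0 < D m)%N && zrun i m then a m i 0%N else 0)%:P * fiber i.
  move=> im; case: (leqP s i) => si; first by rewrite (hl i) // mulrA dvdp_mull.
  case: ifP => [/andP[_ /smin]|_]; first by rewrite leqNgt si.
  by rewrite mul0r dvdp0.
have dvs : fiber s %| 'X^n.
  apply: dvdp_trans dv; rewrite fiberS //; apply: dvdp_sub.
    by rewrite (hl m) // mulrA dvdp_mull.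
  elim/big_rec: _ => [|i p _ IH]; first exact: dvdp0.
  by rewrite dvdp_add ?term ?leq_ord.
have hs : fiber s = 'X^s.
  by have [ms ss] := fiber_monic s; rewrite [LHS](monic_dvd_Xn ms dvs) ss.
have hm : fiber m.+1 = 'X^(m.+1).
  by have [ms ss] := fiber_monic m.+1; rewrite [LHS](monic_dvd_Xn ms dv) ss.
rewrite ltnS leq_eqVlt => /predU1P[->|rm].
  move=> lm _ z.
  have /eqP := fiberS m c1; rewrite hm (hl m) // hs -exprD subnK // -exprS eq_sym.
  rewrite -subr_eq0 addrAC subrr add0r oppr_eq0 => /eqP e.
  have : \poly_(i < m.+1) (if (0 < D m)%N && zrun i m then a m i 0%N else 0) = 0.
    rewrite poly_def -[RHS]e; apply: eq_bigr => i _; rewrite -mul_polyC.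
    case: ifP => [/andP[_ zi]|_]; last by rewrite !mul0r.
    by rewrite (hl i) ?leq_ord ?smin // hs -exprD subnK ?smin.
  by move/polyP/(_ l); rewrite coef_poly coef0 ltnS lm Dm z.
move=> lr Dr z; case: (leqP s r') => sr.
  have [_] := zl r' sr (ltnW rm); rewrite big_ltn // addn_eq0.
  by case: (D r') Dr.
by apply: (IHm s) => //.
Qed.

(** The basis elements of index less than [t] vanish at y = 0, and the others become
    multiples of H_t by powers of x. *)
Lemma span_ideal_ev0 p : diag_trivial -> J p -> fiber t %| ev0 p.
Proof.
move=> c1 [n [q ->]]; rewrite rmorph_sum /=.
elim/big_rec: _ => [|s u _ IH]; first exact: dvdp0.
rewrite dvdp_add // rmorphM dvdp_mull //= /stair_basis rmorphM /= map_polyC /=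
  /horner_eval.
case: (ltnP s t) => st.
  by rewrite diag_trivial_lead_prod // hornerXn expr0n eqn0Ngt mu_gt0 //= mul0r dvdp0.
rewrite lead_prod_high // hornerC mul1r -/(fiber s) (fiber_zrun c1 st) ?dvdp_mull //.
by rewrite big_nat_cond big1 // => i /andP[/andP[ti _] _]; rewrite D_high.
Qed.

(** Every term of the binomial expansion contains f^n or g^m. *)
Lemma rad_add (T : comNzRingType) (I : T -> Prop) (f g : T) n m :
  I 0 -> (forall p q, I p -> I q -> I (p + q)) -> (forall p q, I q -> I (p * q)) ->
  I (f ^+ n) -> I (g ^+ m) -> I ((f + g) ^+ (n + m)).
Proof.
move=> I0 ID IM If Ig; rewrite exprDn.
elim/big_rec: _ => // i p _ Ip; apply: (ID) => //.
rewrite -mulr_natl; apply: (IM).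
case: (leqP m i) => mi.
  by rewrite -(subnK mi) exprD; apply: (IM); apply: (IM).
rewrite mulrC; apply: (IM); have -> : (n + m - i = (m - i) + n)%N by lia.
by rewrite exprD; apply: (IM).
Qed.

Lemma radical_ideal I : is_ideal I -> is_ideal (radical (k := k) I).
Proof.
case=> I0 ID IM; split.
- by exists 1%N; rewrite expr1.
- by move=> f g [n In] [m Im]; exists (n + m)%N; apply: rad_add.
by move=> f g [n In]; exists n; rewrite exprMn; apply: IM.
Qed.

Lemma xy_ideal (f : R) : (phi f)`_0`_0 = 0 ->
  ideal_gen (fun g => g = varx k \/ g = vary k) f.
Proof.
move=> f0 I [I0 ID IM] gen.
have [p [q e]] : exists p q, phi f = p * 'X + q * 'X%:P.
  move: f0; elim/poly_ind: (phi f) => [|p c _]; first by exists 0, 0;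
    rewrite !mul0r addr0.
  rewrite coefD coefMX /= add0r coefC /=.
  elim/poly_ind: c => [|c b _]; first by exists p, 0; rewrite mul0r.
  rewrite coefD coefMX /= add0r coefC /= => ->; exists p, c%:P.
  by rewrite addr0 polyCM.
have [[p' ep] [q' eq]] := (phi_surj p, phi_surj q).
have -> : f = p' * varx k + q' * vary k.
  by apply: phi_inj; rewrite rmorphD !rmorphM /= phi_x phi_y ep eq.
by apply: ID; apply: IM; apply: gen; [left|right].
Qed.

(** One direction restricts a power of x in the ideal to y = 0.  In the other,
    x^t is congruent to H_t = F_t modulo y, and y is nilpotent. *)
Lemma V2_cond : V2 E (param_ideal t D a) <-> nilpotent_params.
Proof.
have [iI _] := param_ideal_V0 D_high EP a.
split=> [[_ rad]|c2].
  have [|ny Jy] := (rad (vary k)).2; first by move=> I _; apply; right.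
  have [|nx Jx] := (rad (varx k)).2; first by move=> I _; apply; left.
  have c1 : diag_trivial.
    by apply: (@span_ideal_yn ny); move: Jy;
      rewrite /param_ideal rmorphXn /= phi_y polyC_exp.
  split=> // r l rt; apply: (@fiber_nilpotent_params nx t) => //.
  move: Jx; rewrite /param_ideal rmorphXn /= phi_x => /(span_ideal_ev0 c1).
  by rewrite rmorphXn /= map_polyX.
have c1 := c2.1; have ht := nilpotent_params_fiber c2 (leqnn t).
have Jy := diag_trivial_yn c1; have lJ := span_ideal_lead_ideal D_high a.
split; first exact: param_ideal_V0.
move=> f; split=> [[n]|].
  rewrite /param_ideal rmorphXn /= => /(span_ideal_ev0 c1);
    rewrite ht rmorphXn /= => /dvdpP[q e].
  apply: xy_ideal; apply/eqP.
  have : (ev0 (phi f) ^+ n)`_0 = 0.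
    by rewrite e coefMXn t_gt0.
  rewrite -horner_coef0 horner_exp horner_coef0 coef_map /= /horner_eval horner_coef0.
  by move/eqP; rewrite expf_eq0 => /andP[].
apply; first exact: radical_ideal.
move=> g [->|->]; last first.
  by exists (mu 0); rewrite /param_ideal rmorphXn /= phi_y -polyC_exp.
(* x^t = F_t - y q, where F_t and y^(mu 0) lie in the ideal. *)
exists (t * (1 + mu 0))%N; rewrite /param_ideal rmorphXn /= phi_x exprM.
have [q eq] := ymod (F t).
have eF : ev0 (F t) = 'X^t by rewrite /stair_basis lead_prod_high // mul1r -/(fiber
  t) ht.
have -> : 'X^t = F t + - 'X%:P * q.
  by rewrite {1}eq eF map_polyXn mulNr addrC addKr.
apply: rad_add; [exact: lead0 lJ|exact: leadD lJ|exact: leadM lJ| |].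
  by rewrite expr1; apply: span_gen.
by rewrite exprMn mulrC exprNn -polyC_exp; apply: (leadM lJ); apply: (leadM lJ).
Qed.

End Subfamilies.

(** * Homogeneous ideals *)

Section Homogeneous.

Variable k : fieldType.
Local Notation R := {mpoly k[2]}.
Local Notation P2 := {poly {poly k}}.

Definition hom_comp (d : nat) (p : P2) : P2 :=
  \poly_(i < size p) \poly_(j < size (p`_i)%R) (if (i + j == d)%N then p`_i`_j else 0).

Lemma coef_hom_comp d p i j : (hom_comp d p)`_i`_j =
  if (i + j == d)%N then p`_i`_j else 0.
Proof.
rewrite coef_poly; case: ltnP => ip; last first.
  by rewrite (nth_default 0 ip) !coef0 if_same.
rewrite coef_poly; case: ltnP => // jp.
by rewrite (nth_default 0 jp) if_same.
Qed.

Lemma phi_pihomog d (f : R) : phi (pihomog mdeg d f) = hom_comp d (phi f).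
Proof.
apply/polyP => i; apply/polyP => j; rewrite coef_hom_comp !coef_phi pihomogE.
have -> : (i + j)%N = mdeg (bimon i j) by rewrite mdeg_xy xdeg_bimon ydeg_bimon.
move: (bimon i j) => n; rewrite {3}(mpolyE f) !raddf_sum /= big_mkcond /=.
case: ifP => nd; last rewrite big1 // => m _.
  apply: eq_bigr => m _; rewrite mcoeffZ mcoeffX; case: (eqVneq m n) => [->|_];
    last first.
    by rewrite mulr0; case: ifP => _ //; rewrite mulr0 ?mcoeffZ ?mcoeffX.
  by rewrite nd mulr1.
by case: ifP => md //; rewrite mcoeffZ mcoeffX; case: (eqVneq m n) md => [->|_ _];
  rewrite ?nd ?mulr0.
Qed.

Lemma hom_compD d p q : hom_comp d (p + q) = hom_comp d p + hom_comp d q.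
Proof.
apply/polyP => i; apply/polyP => j; rewrite coefD [RHS]coefD !coef_hom_comp !coefD.
by case: ifP; rewrite ?addr0.
Qed.

Lemma hom_compN d p : hom_comp d (- p) = - hom_comp d p.
Proof.
apply/polyP => i; apply/polyP => j; rewrite coefN [RHS]coefN !coef_hom_comp !coefN.
by case: ifP; rewrite ?oppr0.
Qed.

Lemma hom_comp0 d : hom_comp d 0 = 0.
Proof. by apply/polyP => i; apply/polyP => j; rewrite coef_hom_comp !coef0 if_same. Qed.

Lemma hom_comp_sum d n (G : nat -> P2) :
  hom_comp d (\sum_(s < n) G s) = \sum_(s < n) hom_comp d (G s).
Proof.
elim: n => [|n IHn]; first by rewrite !big_ord0 hom_comp0.
by rewrite !big_ord_recr hom_compD IHn.
Qed.

Lemma hom_compX d p : hom_comp d.+1 ('X * p) = 'X * hom_comp d p.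
Proof.
apply/polyP => i; apply/polyP => j; rewrite coef_hom_comp !coefXM.
case: i => [|i] /=; first by rewrite !coef0 if_same.
by rewrite coef_hom_comp addSn eqSS.
Qed.

Lemma hom_compXn d e p : hom_comp (d + e) (('X^e)%:P * p) = ('X^e)%:P * hom_comp d p.
Proof.
apply/polyP => i; apply/polyP => j; rewrite coef_hom_comp !coefCM !coefXnM.
case: ltnP => je; first by rewrite if_same.
by rewrite coef_hom_comp; congr (if _ then _ else _); apply/eqP/eqP; lia.
Qed.

Lemma hom_comp_mon d w e (c : k) p : hom_comp w p = p ->
  hom_comp d ((c *: 'X^e)%:P * p) = if (e + w == d)%N then (c *: 'X^e)%:P * p else 0.
Proof.
move=> hp; apply/polyP => i; apply/polyP => j; rewrite coef_hom_comp.
rewrite (fun_if (fun q : P2 => q`_i`_j)) !coefCM !coef0 -scalerAl coefZ coefXnM.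
case: ltnP => je; first by rewrite mulr0 !if_same.
rewrite -hp coef_hom_comp; case: (eqVneq (i + (j - e))%N w) => ijw;
  last by rewrite mulr0 !if_same.
suff -> : (i + j == d)%N = (e + w == d)%N by [].
by rewrite -ijw; congr (_ == _); lia.
Qed.

Lemma hom_comp_C d (q : {poly k}) p w : hom_comp w p = p ->
  hom_comp d (q%:P * p) =
    \sum_(e < size q) (if (e + w == d)%N then (q`_e *: 'X^e)%:P * p else 0).
Proof.
move=> hp; rewrite -{1}(coefK q) poly_def raddf_sum /= mulr_suml.
rewrite (hom_comp_sum d (size q) (fun e => (q`_e *: 'X^e)%:P * p)).
by apply: eq_bigr => e _; rewrite (hom_comp_mon _ _ _ hp).
Qed.

Variables (t : nat) (D : nat -> nat) (E : R -> Prop).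
Local Notation mu := (mu t D).
Hypothesis D_high : forall r, (t <= r)%N -> D r = 0%N.
Hypothesis EP : forall f, E f <-> forall m, m \in msupp f -> (mu (xdeg m) <= ydeg m)%N.

Variable a : nat -> nat -> nat -> k.
Local Notation F := (stair_basis t D a).
Local Notation J := (span_ideal t D a).

(** The degree of the leading monomial of [F r]. *)
Definition wt r : nat := (r + mu r)%N.

Definition homogeneous_params : Prop :=
  diag_trivial t D a /\ forall r l p, (r < t)%N -> (l <= r)%N ->
  (p < D r)%N -> (p + wt l != (wt r).+1)%N -> a r l p = 0.

(** The part of B_(r,l) for which B_(r,l) [F l] has the degree of x [F r]. *)
Definition hom_low_coef r l : {poly k} :=
  \poly_(p < D r) (if (p + wt l == (wt r).+1)%N then a r l p else 0).

Lemma wt_rec r : (D r + wt r.+1)%N = (wt r).+1.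
Proof. by rewrite /wt (mu_rec D_high r); lia. Qed.

Lemma hom_comp_low_coef r l : hom_comp (wt l) (F l) = F l ->
  hom_comp (wt r).+1 ((low_coef D a r l)%:P * F l) = (hom_low_coef r l)%:P * F l.
Proof.
move=> hF; rewrite /low_coef /hom_low_coef !poly_def !raddf_sum /= !mulr_suml.
rewrite (hom_comp_sum _ _ (fun p => (a r l p *: 'X^p)%:P * F l)); apply: eq_bigr => p _.
by rewrite (hom_comp_mon _ _ _ hF); case: ifP; rewrite // scale0r mul0r.
Qed.

Lemma hom_comp_F0 : diag_trivial t D a -> hom_comp (wt 0) (F 0) = F 0.
Proof.
move=> c1; rewrite /stair_basis monic_part0 mulr1 diag_trivial_lead_prod //.
apply/polyP => i; apply/polyP => j; rewrite coef_hom_comp coefC.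
case: (i =P 0%N) => [->|_]; last by rewrite coef0 if_same.
by rewrite coefXn /wt !add0n; case: eqP.
Qed.

(** The component of degree [(wt r).+1] of the relation. *)
Lemma hom_comp_relation r : diag_trivial t D a -> (forall l, (l <= r)%N ->
  hom_comp (wt l) (F l) = F l) ->
  ('X^(D r))%:P * hom_comp (wt r.+1) (F r.+1) =
    'X * F r - \sum_(l < r.+1) (hom_low_coef r l)%:P * F l.
Proof.
move=> c1 hF; rewrite -hom_compXn addnC wt_rec -(diag_trivial_diag_coef D_high r c1)
  stair_basis_relations //.
rewrite hom_compD hom_compN hom_compX hF // (hom_comp_sum _ _ (fun l =>
  (low_coef D a r l)%:P * F l)).
by congr (_ - _); apply: eq_bigr => l _; rewrite hom_comp_low_coef // hF // leq_ord.
Qed.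

Lemma homogeneous_params_hom_comp r : homogeneous_params -> hom_comp (wt r) (F r) = F r.
Proof.
move=> [c1 c3]; elim: r {-2}r (leqnn r) => [|n IHn] r.
  by rewrite leqn0 => /eqP ->; apply: hom_comp_F0.
rewrite leq_eqVlt => /predU1P[->|]; last exact: IHn.
have C0 : ('X^(D n))%:P != 0 :> P2 by rewrite polyC_eq0 monic_neq0 ?monicXn.
apply: (mulfI C0); rewrite (hom_comp_relation c1 IHn).
rewrite -{1}(diag_trivial_diag_coef D_high n c1) (stair_basis_relations D_high a n).
congr (_ - _); apply: eq_bigr => l _; congr (_%:P * _).
apply/polyP => i; rewrite !coef_poly; case: ltnP => // iD.
case: (ltnP n t) => nt; last by rewrite D_high in iD.
by case: eqP => // /eqP ne; rewrite c3 // leq_ord.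
Qed.

Lemma hom_comp_lead : diag_trivial t D a -> forall r,
  (size (hom_comp (wt r) (F r)) <= r.+1)%N /\ (hom_comp (wt r) (F r))`_r = 'X^(mu r).
Proof.
move=> c1 r; have [sF eF] := stair_basis_lead t D a r; split.
  by apply: leq_trans (size_poly _ _) _; rewrite sF.
apply/polyP => j; rewrite coef_hom_comp eF diag_trivial_lead_prod // /wt eqn_add2l
  coefXn.
by case: eqP.
Qed.

(** The components of degree [wt r] of the [F r] lie in the ideal, keep the leading
    coefficients and satisfy relations within the degree bounds, so uniqueness
    identifies them with the [F r]. *)
Lemma hom_homogeneous_params : (forall d p, J p -> J (hom_comp d p)) ->
  homogeneous_params.
Proof.
move=> hom; have JF s : J (F s) by apply: span_gen.
have c1 : diag_trivial t D a.
  (* The top component of F_0 = g_0 is y^(mu 0). *)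
  apply: (span_ideal_yn (n := mu 0)).
  have := hom (mu 0) _ (JF 0); congr (span_ideal _ _ _).
  rewrite /stair_basis monic_part0 mulr1; apply/polyP => i; apply/polyP => j.
  rewrite coef_hom_comp !coefC; case: (i =P 0%N) => [->|_];
    last by rewrite coef0 if_same.
  have mon : lead_prod t (diag_coef D a) 0 \is monic by apply: lead_prod_monic;
    apply: diag_coef_monic.
  have sz : size (lead_prod t (diag_coef D a) 0) = (mu 0).+1.
    by apply: (size_lead_prod t (D := D)) => q;
      [apply: diag_coef_monic|apply: size_diag_coef].
  rewrite add0n coefXn; case: eqP => // ->.
  by move: mon; rewrite monicE lead_coefE sz => /eqP.
have step r : (forall l, (l <= r)%N -> hom_comp (wt l) (F l) = F l) ->
    hom_comp (wt r.+1) (F r.+1) = F r.+1 /\ forall s, (s <= r)%N ->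
      hom_low_coef r s = low_coef D a r s.
  move=> hF; have [sz le] := hom_comp_lead c1 r.+1.
  apply: (step_unique (J := J) (C := 'X^(D r)) (t := t) (D := D)) => //.
  - exact: span_ideal_lead_ideal.
  - exact: stair_basis_shaped.
  - by rewrite monic_neq0 ?monicXn.
  - by move=> s _; rewrite size_polyXn ltnS size_low_coef.
  - by move=> s _; rewrite size_polyXn ltnS size_poly.
  - exact: hom.
  - by rewrite le monicXn.
  - by rewrite le size_polyXn.
  - by rewrite -(diag_trivial_diag_coef D_high r c1) stair_basis_relations.
  exact: hom_comp_relation.
have hF r : hom_comp (wt r) (F r) = F r.
  elim: r {-2}r (leqnn r) => [|n IHn] r.
    by rewrite leqn0 => /eqP ->; apply: hom_comp_F0.
  rewrite leq_eqVlt => /predU1P[->|]; last exact: IHn.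
  by have [] := step n (fun l ln => IHn l ln).
split=> // r l p rt lr pD ne.
have [_ /(_ l lr) /polyP/(_ p)] := step r (fun l _ => hF l).
by rewrite !coef_poly pD (negPf ne).
Qed.

Lemma V3_cond : V3 E (param_ideal t D a) <-> homogeneous_params.
Proof.
split=> [[_ hom]|c3].
  apply: hom_homogeneous_params => d p; have [f <-] := phi_surj p => Jf.
  by rewrite -phi_pihomog; apply: hom.
split; first exact: param_ideal_V0.
move=> f; rewrite /param_ideal => -[n [q e]] d; rewrite phi_pihomog e.
rewrite (hom_comp_sum _ _ (fun s => (q s)%:P * F s));
  apply: (span_sum (G := fun s => hom_comp d ((q s)%:P * F s))) => s _.
rewrite (hom_comp_C _ _ (homogeneous_params_hom_comp s c3)).
apply: (span_sum (G := fun e : nat =>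
  if (e + wt s == d)%N then ((q s)`_e *: 'X^e)%:P * F s else 0)) => i _.
by case: ifP => _; [apply: spanZ; apply: span_gen|apply: span0].
Qed.

End Homogeneous.

(** * Counting the parameters *)

Section Counting.
Local Open Scope nat_scope.

Variables (t : nat) (D : nat -> nat).
Hypothesis D_high : forall r, (t <= r)%N -> D r = 0%N.
Local Notation mu := (mu t D).
Local Notation wt := (wt t D).
Local Notation zrun l r := ((\sum_(l <= q < r) D q) == 0)%N.

Definition param_index : seq (nat * nat * nat) :=
  [seq (rl, p) | rl <- [seq (r, l) | r <- iota 0 t, l <- iota 0 r.+2],
                 p <- iota 0 (D rl.1)].

Lemma mem_param_index r l p : ((r, l, p) \in param_index) =
  [&& (r < t)%N, (l <= r.+1)%N & (p < D r)%N].
Proof.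
apply/allpairsPdep/and3P => [[rl [p' [/allpairsPdep[r' [l' []]]]]]|[rt lr pD]].
  rewrite !mem_iota => /andP[_ rt] /andP[_ lr] ->.
  by move=> /andP[_ pD] [-> -> ->].
exists (r, l), p; rewrite mem_iota; split=> //.
by apply/allpairsPdep; exists r, l; rewrite !mem_iota.
Qed.

Lemma uniq_param_index : uniq param_index.
Proof.
apply: allpairs_uniq_dep => [|rl _|]; rewrite ?iota_uniq //.
  apply: allpairs_uniq_dep => [|r _|]; rewrite ?iota_uniq //.
  by move=> [r l] [r' l'] _ _ /= [-> ->].
by move=> [[r l] p] [[r' l'] p'] _ _ /= [-> -> ->].
Qed.

Lemma count_param_index (P : pred (nat * nat * nat)) :
  count P param_index = \sum_(r < t) \sum_(l < r.+2) \sum_(p <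
    D r) P (r : nat, l : nat, p : nat).
Proof.
have i0 n (G : nat -> nat) : \sum_(i <- iota 0 n) G i = \sum_(i < n) G i.
  by rewrite -[in iota 0 n](subn0 n) -/(index_iota 0 n) big_mkord.
rewrite -sum1_count big_mkcond /=.
rewrite (eq_bigr (fun z => P z : nat)) => [|z _]; last by case: (P z).
rewrite big_allpairs_dep big_allpairs_dep i0; apply: eq_bigr => r _.
by rewrite i0; apply: eq_bigr => l _; rewrite i0.
Qed.

(** The drop after column [q] contributes to the heights of columns [0], ..., [q]. *)
Lemma sum_mu : (\sum_(r < t) mu r = \sum_(q < t) q.+1 * D q)%N.
Proof.
transitivity (\sum_(r < t) \sum_(q < t | (r <= q)%N) D q)%N.
  apply: eq_bigr => r _; rewrite /mu -(big_mkord (fun q => (r <= q)%N)).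
  rewrite (big_cat_nat (leq0n r) (ltnW (ltn_ord r))) /= [X in (X + _)%N]big_nat_cond.
  rewrite [X in (X + _)%N]big1 ?add0n => [|q]; last by case/andP=> /andP[_ qr];
    rewrite leqNgt qr.
  by rewrite [LHS]big_nat_cond [RHS]big_nat_cond; apply: eq_bigl => q;
    case: (r <= q)%N; rewrite ?andbF ?andbT.
rewrite (exchange_big_dep predT) //=; apply: eq_bigr => q _.
by rewrite -(big_ord_widen t (fun=> D q) (ltn_ord q)) sum_nat_const card_ord.
Qed.

Lemma size_param_index : size param_index = (\sum_(r < t) mu r + mu 0)%N.
Proof.
rewrite -count_predT count_param_index sum_mu /mu big_mkord -big_split /=.
apply: eq_bigr => r _; rewrite (eq_bigr (fun=> D r)) => [|l _].
  by rewrite sum_nat_const card_ord; lia.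
by rewrite sum_nat_const card_ord muln1.
Qed.

Lemma count_lower (P : pred (nat * nat * nat)) :
  (count (fun z => (z.1.2 != z.1.1.+1) && P z) param_index =
   \sum_(r < t) \sum_(l < r.+1) \sum_(p < D r) P (r : nat, l : nat, p : nat))%N.
Proof.
rewrite count_param_index; apply: eq_bigr => r _; rewrite big_ord_recr /= eqxx.
rewrite [X in (_ + X)%N]big1 ?addn0 //; apply: eq_bigr => l _.
by rewrite ltn_eqF.
Qed.

Lemma count_lower_all : (count (fun z =>
  z.1.2 != z.1.1.+1) param_index = \sum_(r < t) mu r)%N.
Proof.
rewrite -(@eq_count _ (fun z => (z.1.2 != z.1.1.+1) && true)) => [|z];
  last by rewrite andbT.
rewrite (count_lower predT) sum_mu; apply: eq_bigr => r _.
rewrite (eq_bigr (fun=> D r)) => [|l _]; first by rewrite sum_nat_const card_ord.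
by rewrite sum_nat_const card_ord muln1.
Qed.

(** Grouping the columns into blocks that end with a drop partitions [0, ..., T - 1],
    except for a last run of columns without drop, which the second sum counts. *)
Lemma count_runs T : (\sum_(r < T) \sum_(l < r.+1) ((0 < D r) && zrun l r) +
  \sum_(l < T) zrun l T = T)%N.
Proof.
elim: T => [|T IHT]; first by rewrite !big_ord0.
rewrite big_ord_recr /=; apply: etrans (congr1 S IHT); rewrite -addnS -addnA;
  congr (_ + _)%N.
have zT : (\sum_(l < T.+1) zrun l T = (\sum_(l < T) zrun l T).+1)%N.
  by rewrite big_ord_recr /= big_geq // addn1.
have zS (l : 'I_T.+1) : zrun l T.+1 = zrun l T && (D T == 0%N).
  by rewrite big_nat_recr ?leq_ord //= addn_eq0.
rewrite -zT; case: (posnP (D T)) => DT.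
  by rewrite big1 ?add0n //; apply: eq_bigr => l _; rewrite zS DT eqxx andbT.
rewrite [X in (_ + X)%N]big1 ?addn0 // => l _.
by rewrite zS (gtn_eqF DT) andbF.
Qed.

(** The column [t.-1] has a drop, so every column belongs to a block, and the
    blocks contain t columns altogether. *)
Lemma count_free2 : (forall r, (r < t)%N -> (0 < mu r)%N) ->
  (count (fun z => (z.1.2 != z.1.1.+1) && ~~ ((z.2 == 0) && zrun z.1.2 z.1.1))
    param_index + t =
   \sum_(r < t) mu r)%N.
Proof.
move=> mu_gt0; rewrite (count_lower (fun z => ~~ ((z.2 == 0) && zrun z.1.2 z.1.1))) /=.
have := count_runs t; rewrite [X in (_ + X)%N]big1 ?addn0 => [|l _]; last first.
  by have := mu_gt0 l (ltn_ord l); rewrite /mu lt0n => /negPf ->.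
move=> e; apply: etrans (congr1 (addn _) (esym e)) _; rewrite sum_mu -big_split /=;
  apply: eq_bigr => r _.
rewrite -big_split /= -[X in (X * _)%N]card_ord -sum_nat_const; apply: eq_bigr => l _.
case: (D r) => [|n]; first by rewrite big_ord0.
rewrite big_ord_recl /= [X in _ + X + _](_ : _ = n).
  by case: (_ == _); rewrite ?addn0 ?add0n ?addn1.
by rewrite -[RHS]card_ord -sum1_card; apply: eq_bigr.
Qed.

Lemma sum_eq_shift n x y : (\sum_(p < n) (p + x == y) = ((x <= y) && (y - x < n)))%N.
Proof.
have [yx|yx] := boolP ((x <= y) && (y - x < n))%N; last first.
  by rewrite big1 // => p _; have := ltn_ord p; case: eqP => //; lia.
have /andP[xy yn] := yx; rewrite (bigD1 (Ordinal yn)) //= subnK // eqxx big1 // => p.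
by rewrite -val_eqE /=; case: eqP => //; lia.
Qed.

(** The pair (i, j) of the numerical data corresponds to l = t + 1 - i and
    r = t - j; the exponent u_ij is then [(wt r).+1 - wt l]. *)
Lemma card_SE (m : nat -> nat) : (forall r, (r <= t)%N -> mu r = m (t - r)%N) ->
  (count (fun z => (z.1.2 != z.1.1.+1) && (z.2 +
    wt z.1.2 == (wt z.1.1).+1)) param_index =
   #|SE t m|)%N.
Proof.
move=> muE; rewrite (count_lower (fun z => z.2 + wt z.1.2 == (wt z.1.1).+1)%N) /=.
under eq_bigr => r _ do under eq_bigr => l _ do rewrite sum_eq_shift.
rewrite -sum1_card [RHS]big_mkcond /=.
transitivity (\sum_(i < t.+2) \sum_(j < t.+1) (if (i, j) \in SE t m then 1 else 0));
  last first.
  by rewrite pair_bigA /=; apply: eq_bigr => -[i j] _.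
(* The substitutions r = t - j and l = t + 1 - i. *)
rewrite [RHS]exchange_big [RHS](reindex_inj rev_ord_inj) [RHS]big_ord_recr /=.
rewrite [X in (_ + X)%N]big1 ?addn0 => [|i _]; last by rewrite inE /= subnn.
apply: eq_bigr => r _; rewrite [RHS](reindex_inj rev_ord_inj) /=.
have rt := ltn_ord r.
rewrite (big_ord_widen t.+2 (fun l =>
  ((wt l <= (wt r).+1) && ((wt r).+1 - wt l < D r))%N : nat)); last by lia.
rewrite big_mkcond /=; apply: eq_bigr => l _; rewrite inE /= !subSS.
have lt := ltn_ord l; case: ltnP => lr; last by rewrite ifF //; lia.
rewrite /uE /dE /wt.
have -> : (t.+1 - l).-1 = t - l by lia.
have -> : (t - r).-1 = t - r.+1 by lia.
rewrite -!muE; try lia.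
rewrite (mu_rec D_high r); set x := mu r.+1; set y := mu l.
have bE (b b' : bool) : b = b' -> (b : nat) = if b' then 1 else 0 by move=> ->;
  case: b'.
by apply: bE; lia.
Qed.

End Counting.

(** * The dimension of the quotient by E *)

Section Dimension.

Variable k : fieldType.
Local Notation R := {mpoly k[2]}.
Variables (t : nat) (D : nat -> nat) (E : R -> Prop).
Local Notation mu := (mu t D).
Hypothesis EP : forall f, E f <-> forall m, m \in msupp f -> (mu (xdeg m) <= ydeg m)%N.

Definition std_mons : seq 'X_{1..2} :=
  [seq bimon i j | i <- iota 0 t, j <- iota 0 (mu i)].

Lemma mem_std_mons m : (m \in std_mons) = (ydeg m < mu (xdeg m))%N.
Proof.
apply/allpairsPdep/idP => [[i [j []]]|lt].
  by rewrite !mem_iota => /andP[_ it] /andP[_ jm] ->; rewrite xdeg_bimon ydeg_bimon.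
exists (xdeg m), (ydeg m); rewrite bimonK !mem_iota lt; split=> //=.
by rewrite add0n ltnNge; apply: contraL lt => /mu_high ->.
Qed.

Lemma size_std_mons : size std_mons = (\sum_(r < t) mu r)%N.
Proof.
rewrite size_allpairs_dep sumnE big_map -[in iota 0 t](subn0 t) -/(index_iota 0 t).
by rewrite big_mkord; apply: eq_bigr => i _; rewrite size_iota.
Qed.

Lemma uniq_std_mons : uniq std_mons.
Proof.
apply: allpairs_uniq_dep => [|i _|]; rewrite ?iota_uniq //.
by move=> [i j] [i' j'] _ _ /= /eqP; rewrite bimon_inj => /andP[/eqP -> /eqP ->].
Qed.

(** The monomials below the staircase give coordinates on R/E.  In these coordinates
    the given basis of R/E is a matrix that is both row-free and row-full, so it is
    square. *)
Lemma quot_dim_std d : quot_dim E d -> d = (\sum_(r < t) mu r)%N.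
Proof.
case=> b bP; rewrite -size_std_mons.
set n := size std_mons; pose v (i : 'I_n) := tnth (in_tuple std_mons) i.
pose S (f : R) : 'rV[k]_n := \row_i f@_(v i).
have ES f : E f <-> S f = 0.
  rewrite EP; split=> [h|/rowP h m mf].
    apply/rowP => i; rewrite !mxE; apply/eqP; rewrite mcoeff_eq0; apply/negP => /h.
    rewrite leqNgt -mem_std_mons => /negP[]; exact: mem_tnth.
  rewrite leqNgt -mem_std_mons; apply/negP => ms.
  have /tnthP[i vi] : m \in in_tuple std_mons by [].
  by have := h i; rewrite !mxE /v -vi; apply/eqP; rewrite -mcoeff_msupp.
(* Row i holds the coordinates of b_i. *)
pose B : 'M[k]_(d, n) := \matrix_(i, j) S (b i) 0 j.
have SB f (c : 'rV[k]_d) : E (f - \sum_i c 0 i *: b i) <-> S f = c *m B.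
  rewrite ES; have -> : S (f - \sum_i c 0 i *: b i) = S f - c *m B.
    apply/rowP => j; rewrite !mxE mcoeffB raddf_sum /=; congr (_ - _).
    by apply: eq_bigr => i _; rewrite mcoeffZ !mxE.
  by split=> [/eqP|->]; rewrite ?subrr // subr_eq0 => /eqP.
have full : row_full B.
  rewrite -sub1mx; apply/row_subP => j; apply/submxP.
  have [c [/SB Hc _]] := bP 'X_[v j]; exists c; rewrite -Hc.
  apply/rowP => i; rewrite !mxE mcoeffX /v.
  have /tuple_uniqP vinj : uniq (in_tuple std_mons) := uniq_std_mons.
  by rewrite (inj_eq vinj).
have free : row_free B.
  rewrite -kermx_eq0; apply/rowV0P => u /sub_kermxP uB.
  have [c [_ cu]] := bP 0.
  have S0 : S 0 = 0 by apply/rowP => i; rewrite !mxE mcoeff0.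
  rewrite -(cu u); first by apply: cu; apply/SB; rewrite mul0mx.
  by apply/SB; rewrite uB.
by rewrite -(eqP free : \rank B = d); apply/eqP.
Qed.

End Dimension.

(** * The parameters as coordinates *)

Section ParameterSpace.

Variable k : fieldType.
Variables (t : nat) (D : nat -> nat) (n : nat).
Hypothesis size_n : size (param_index t D) = n.

Definition index_triple (i : 'I_n) : nat * nat * nat :=
  nth (0, 0, 0)%N (param_index t D) i.

(** The parameters of the generic point: the coordinate attached to the given
    triple, or 0 if there is none.  There is at most one, by [index_triple_inj]. *)
Definition generic_param r l p : {mpoly k[n]} :=
  \sum_(i < n | index_triple i == (r, l, p)) 'X_i.

(** Defined by evaluation at the generic point, so that every construction that
    commutes with ring morphisms specializes to it. *)
Definition param_value (a : 'rV[k]_n) r l p : k := (generic_param r l p).@[a 0].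

Lemma index_triple_inj : injective index_triple.
Proof.
move=> i j /eqP; rewrite /index_triple nth_uniq ?size_n ?uniq_param_index //.
by move/eqP/val_inj.
Qed.

Lemma param_value_index_triple a i r l p : index_triple i = (r, l, p) ->
  param_value a r l p = a 0 i.
Proof.
move=> e; rewrite /param_value /generic_param (big_pred1 i) ?mevalXU // => j.
by rewrite -e; apply: inj_eq index_triple_inj _ _.
Qed.

Lemma index_triple_mem i : index_triple i \in param_index t D.
Proof. by apply: mem_nth; rewrite size_n. Qed.

Lemma index_triple_ex z : z \in param_index t D -> exists i, index_triple i = z.
Proof.
move=> zi; have lt : (index z (param_index t D) < n)%N by rewrite -size_n index_mem.
by exists (Ordinal lt); rewrite /index_triple nth_index.
Qed.

Lemma param_value_vanish a (P : pred (nat * nat * nat)) :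
  (forall r l p, (r, l, p) \in param_index t D -> P (r, l, p) ->
    param_value a r l p = 0) <->
  forall j, j \in [set i | P (index_triple i)] -> a 0 j = 0.
Proof.
split=> h.
  move=> j; rewrite inE; case e : (index_triple j) => [[r l] p] Pj.
  by rewrite -(param_value_index_triple a e) h // -e index_triple_mem.
move=> r l p /index_triple_ex[i e] Pi;
  rewrite (param_value_index_triple a e) h // inE e.
exact: Pi.
Qed.

Lemma card_free (P : pred (nat * nat * nat)) :
  #|~: [set i | P (index_triple i)]| = count (predC P) (param_index t D).
Proof.
rewrite -sum1_card -sum1_count (big_nth (0, 0, 0)%N) size_n big_mkord.
by apply: eq_bigl => i; rewrite !inE.
Qed.

Lemma param_eq_param_value a b : param_eq t D (param_value a) b ->
  forall i r l p, index_triple i = (r, l, p) -> a 0 i = b r l p.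
Proof.
move=> eqab i r l p e; rewrite -(param_value_index_triple a e).
have := index_triple_mem i; rewrite e mem_param_index => /and3P[*]; exact: eqab.
Qed.

End ParameterSpace.

(** * Leading families from reduced Groebner bases *)

Section GenericGroebner.

Variables (t : nat) (D : nat -> nat).
Hypothesis D_high : forall r, (t <= r)%N -> D r = 0%N.
Local Notation mu := (mu t D).

Section Ring.

Variables (K : comNzRingType) (N : nat) (c : N.-tuple ('X_{1..2} * 'X_{1..2})).
Hypothesis c_lt : forall i, lexlt (tnth c i).2 (tnth c i).1.
Local Notation P2 := {poly {poly K}}.

(** The polynomial f_m for m = x^r y^(mu r), written in K[y][x] so that the lower
    coefficients may be indeterminates. *)
Definition generic_groebner (lam : 'I_N -> K) r : P2 :=
  'X^r * ('X^(mu r))%:P -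
    \sum_(i < N | (tnth c i).1 == bimon r (mu r))
      (lam i)%:P%:P * ('X^(xdeg (tnth c i).2) * ('X^(ydeg (tnth c i).2))%:P).

(** If there is no drop from column [r'] to the next one, x^r y^(mu r) is not a
    minimal generator, and a multiple of the previous polynomial is used. *)
Fixpoint generic_lead (lam : 'I_N -> K) r : P2 :=
  if r is r'.+1 then
    if D r' == 0%N then 'X * generic_lead lam r' else generic_groebner lam r
  else generic_groebner lam 0.

Lemma eq_generic_lead lam1 lam2 r : lam1 =1 lam2 ->
  generic_lead lam1 r = generic_lead lam2 r.
Proof.
move=> e; have eg s : generic_groebner lam1 s = generic_groebner lam2 s.
  by congr (_ - _); apply: eq_bigr => i _; rewrite e.
by elim: r => [|r IHr] /=; rewrite ?eg ?IHr.
Qed.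

(** The lower monomials precede x^r y^(mu r), so in the power x^r they only
    contribute exponents of y below [mu r]. *)
Lemma generic_groebner_lead lam r : (size (generic_groebner lam r) <= r.+1)%N /\
  exists2 q : {poly K}, (size q <= mu r)%N & (generic_groebner lam r)`_r =
    'X^(mu r) + q.
Proof.
have mon (i : 'I_N) : (tnth c i).1 == bimon r (mu r) ->
    (xdeg (tnth c i).2 < r)%N \/
    xdeg (tnth c i).2 = r /\ (ydeg (tnth c i).2 < mu r)%N.
  move=> /eqP e; have := c_lt i; rewrite e /lexlt -!/(xdeg _) -!/(ydeg _).
  rewrite xdeg_bimon ydeg_bimon => /orP[|/andP[/eqP]]; by [left|right].
have szm (u : {poly K}) x : (size ('X^x * u%:P)%R <= x.+1)%N.
  rewrite mulrC mul_polyC; apply: leq_trans (size_scale_leq _ _) _.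
  by rewrite size_polyXn.
split.
  apply: leq_trans (size_polyD _ _) _; rewrite geq_max szm size_polyN.
  apply: leq_trans (size_sum _ _ _) _; apply/bigmax_leqP => i /mon h.
  rewrite mul_polyC; apply: leq_trans (size_scale_leq _ _) _.
  by apply: leq_trans (szm _ _) _; case: h => [|[-> _]]; rewrite ?ltnS // => /ltnW.
rewrite coefB coefMC coefXn eqxx mul1r coef_sum -sumrN; eexists; last reflexivity.
apply: leq_trans (size_sum _ _ _) _; apply/bigmax_leqP => i /mon h.
rewrite size_polyN coefCM coefMC coefXn; case: h => [lt|[-> lt]].
  by rewrite gtn_eqF // mul0r mulr0 size_poly0.
rewrite eqxx mul1r mul_polyC; apply: leq_trans (size_scale_leq _ _) _.
by rewrite size_polyXn.
Qed.

Lemma generic_lead_shaped lam : shaped t D (generic_lead lam).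
Proof.
have main r : (size (generic_lead lam r) <= r.+1)%N /\
  exists2 q : {poly K}, (size q <= mu r)%N & (generic_lead lam r)`_r = 'X^(mu r) + q.
  elim: r => [|r [sz [q sq e]]] /=; first exact: generic_groebner_lead.
  case: eqP => [D0|_]; last exact: generic_groebner_lead.
  split.
    by apply: leq_trans (size_polyMleq _ _) _; rewrite size_polyX.
  have <- : mu r = mu r.+1 by rewrite (mu_rec D_high r) D0.
  by exists q; rewrite // coefXM.
split=> r; have [sz [q sq ->]] := main r.
  by split=> //; rewrite monicE lead_coefDl ?lead_coefXn // size_polyXn ltnS.
by rewrite size_polyDl size_polyXn // ltnS.
Qed.

End Ring.

Section Map.

Variables (K L : comNzRingType) (f : {rmorphism K -> L}).
Variables (N : nat) (c : N.-tuple ('X_{1..2} * 'X_{1..2})) (lam : 'I_N -> K).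
Local Notation map2 := (map_poly (map_poly f)).

Lemma map_generic_groebner r :
  map2 (generic_groebner c lam r) = generic_groebner c (fun i => f (lam i)) r.
Proof.
rewrite /generic_groebner rmorphB rmorphM /= map_polyXn map_polyC /= map_polyXn;
  congr (_ - _).
rewrite rmorph_sum; apply: eq_bigr => i _.
by rewrite !rmorphM /= !map_polyXn !map_polyC /= map_polyXn map_polyC.
Qed.

Lemma map_generic_lead r :
  map2 (generic_lead c lam r) = generic_lead c (fun i => f (lam i)) r.
Proof.
elim: r => [|r IHr] /=; first exact: map_generic_groebner.
case: eqP => _; last exact: map_generic_groebner.
by rewrite rmorphM /= map_polyX IHr.
Qed.

End Map.

Section Field.

Variables (k : fieldType) (E : {mpoly k[2]} -> Prop).
Variables (N : nat) (c : N.-tuple ('X_{1..2} * 'X_{1..2})).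
Hypothesis EP : forall f, E f <-> forall m, m \in msupp f -> (mu (xdeg m) <= ydeg m)%N.

Lemma phi_groebner_poly (lam : 'rV[k]_N) r :
  phi (groebner_poly c lam (bimon r (mu r))) = generic_groebner c (lam 0) r.
Proof.
rewrite /groebner_poly phiB phi_mon xdeg_bimon ydeg_bimon phi_sum.
rewrite /generic_groebner; congr (_ - _); apply: eq_bigr => i _.
by rewrite -mul_mpolyC rmorphM /= phi_mon /phi mmapC.
Qed.

Lemma generic_lead_in (lam : 'rV[k]_N) I : is_ideal I ->
  (forall m, min_gen E m -> I (groebner_poly c lam m)) ->
  forall r, push I (generic_lead c (lam 0) r).
Proof.
move=> /push_ideal[_ _ IM] Igen.
have gen r : (r == 0)%N || (0 < D r.-1)%N -> push I (generic_groebner c (lam 0) r).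
  move=> hr; rewrite -phi_groebner_poly push_phi; apply: Igen.
  by apply/(min_genP D_high EP); rewrite /is_gen xdeg_bimon ydeg_bimon eqxx.
elim=> [|r IHr] /=; first exact: gen.
by case: posnP => [_|Dr]; [apply: IM|apply: gen].
Qed.

End Field.

End GenericGroebner.

(** * Leading families in an arbitrary ideal *)

Section Surjectivity.

Variables (k : fieldType) (t : nat) (D : nat -> nat).
Hypothesis D_high : forall r, (t <= r)%N -> D r = 0%N.

(** Beyond column [t] the height is zero, so multiples of the polynomial chosen in
    column [t] serve there and only finitely many choices are made. *)
Lemma lead_family (J : {poly {poly k}} -> Prop) : lead_ideal t D J ->
  exists f, shaped t D f /\ forall r, J (f r).
Proof.
move=> lJ.
have [g gP] : exists g : 'I_t.+1 -> {poly {poly k}}, forall r : 'I_t.+1,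
    [/\ J (g r), (size (g r) <= r.+1)%N, (g r)`_r \is monic &
        size ((g r)`_r)%R = (mu t D r).+1].
  apply: (fin_all_exists (P := fun (r : 'I_t.+1) p => [/\ J p, (size p <= r.+1)%N,
    p`_r \is monic & size (p`_r)%R = (mu t D r).+1])) => r.
  exact: (lead_ex lJ r).
exists (fun r => 'X^(r - t) * g (inord (minn r t))).
have shift r : minn r t = (inord (minn r t) : 'I_t.+1) /\ (r = r - t + minn r t)%N.
  by rewrite inordK; lia.
have lead r : ('X^(r - t) * g (inord (minn r t)))`_r =
    (g (inord (minn r t)))`_(inord (minn r t) : 'I_t.+1).
  have [e1 e2] := shift r; rewrite coefXnM -e1 ifF; last by lia.
  by congr (_`_ _); lia.
split; last by move=> r; apply: (leadM lJ); have [] := gP (inord (minn r t)).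
split=> r; have [e1 e2] := shift r; have [_ sz mon ssz] := gP (inord (minn r t)).
  rewrite lead; split=> //; apply: leq_trans (size_polyMleq _ _) _.
  by rewrite size_polyXn /= (leq_trans (leq_add (leqnn _) sz)) // -e1; lia.
rewrite lead ssz -e1; congr _.+1.
by case: (leqP r t) => // rt; rewrite !mu_high // ltnW.
Qed.

End Surjectivity.

(** * The staircase of a monomial ideal *)

Section Staircase.

Variables (k : fieldType) (E : {mpoly k[2]} -> Prop).
Hypothesis hE : monomial_ideal E.

Lemma monomial_idealP f : E f <-> forall m, m \in msupp f -> E 'X_[m].
Proof.
have [A EA] := hE; rewrite EA monomial_genP; split=> h m /h.
  case=> b Ab bm; apply/EA/monomial_genP => n; rewrite msuppX inE => /eqP ->.
  by exists b.
by move/EA/monomial_genP; apply; rewrite msuppX inE.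
Qed.

Lemma monomial_ideal_up m n : (m <= n)%MM -> E 'X_[m] -> E 'X_[n].
Proof.
move=> mn; have [A EA] := hE; move/EA/monomial_genP/(_ m).
rewrite msuppX inE eqxx => /(_ isT)[b Ab bm]; apply/EA/monomial_genP => n'.
by rewrite msuppX inE => /eqP ->; exists b => //; apply: lepm_trans mn.
Qed.

Lemma mon_xy i j : varx k ^+ i * vary k ^+ j = 'X_[bimon i j].
Proof.
apply: phi_inj; rewrite rmorphM !rmorphXn /= phi_x phi_y phi_mon xdeg_bimon ydeg_bimon.
by rewrite polyC_exp.
Qed.

Variables (t : nat) (m : nat -> nat).
Hypothesis ht : is_min (fun j => E (varx k ^+ j)) t.
Hypothesis hm : forall i, (i <= t)%N ->
  is_min (fun j => E (varx k ^+ (t - i) * vary k ^+ j)) (m i).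

Definition step_size r : nat := (m (t - r) - m (t - r.+1))%N.
Local Notation D := step_size.

Lemma step_size_high r : (t <= r)%N -> D r = 0%N.
Proof.
move=> tr; rewrite /step_size; have -> : (t - r = 0)%N by lia.
have -> : (t - r.+1 = 0)%N by lia.
exact: subnn.
Qed.

Lemma m_at0 : m 0 = 0%N.
Proof.
apply/eqP; rewrite -leqn0; apply: (hm (leq0n t)).2.
by rewrite subn0 expr0 mulr1; apply: ht.1.
Qed.

Lemma m_incr i : (i < t)%N -> (m i <= m i.+1)%N.
Proof.
move=> it; apply: (hm (ltnW it)).2; have := (hm it).1; rewrite !mon_xy.
by apply: monomial_ideal_up; rewrite lepm_deg !xdeg_bimon !ydeg_bimon leqnn leq_sub2l.
Qed.

Lemma mu_step_size r : (r <= t)%N -> mu t D r = m (t - r)%N.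
Proof.
move=> rt; rewrite -{1}(subKn rt); elim: (t - r)%N (leq_subr r t) => [|i IHi] it.
  by rewrite subn0 mu_high ?m_at0.
rewrite (mu_rec step_size_high) /step_size.
have -> : (t - i.+1).+1 = (t - i)%N by lia.
by rewrite IHi ?(ltnW it) // !subKn ?(ltnW it) // subnK // m_incr.
Qed.

(** Column [r] of the staircase is column [t - r] in the numbering of the numbers
    [m i], which starts from x^t. *)
Lemma staircaseP f : E f <-> forall n, n \in msupp f -> (mu t D (xdeg n) <= ydeg n)%N.
Proof.
rewrite monomial_idealP; suff mon n : E 'X_[n] <-> (mu t D (xdeg n) <= ydeg n)%N.
  by split=> h n /h /mon.
case: (leqP (xdeg n) t) => nt; last first.
  rewrite mu_high ?(ltnW nt) //; split=> // _.
  have := ht.1; rewrite -[_ ^+ t]mulr1 -(expr0 (vary k)) mon_xy.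
  by apply: monomial_ideal_up; rewrite lepm_deg xdeg_bimon ydeg_bimon (ltnW nt).
have [Em mm] := hm (leq_subr (xdeg n) t); rewrite mu_step_size //.
rewrite subKn // in Em mm; split=> [En|le].
  by apply: mm; rewrite mon_xy bimonK.
move: Em; rewrite mon_xy; apply: monomial_ideal_up.
by rewrite lepm_deg xdeg_bimon ydeg_bimon leqnn.
Qed.

Lemma mu_step_size_gt0 r : (r < t)%N -> (0 < mu t D r)%N.
Proof.
move=> rt; rewrite lt0n; apply/negP => /eqP e0.
have := ht.2 r; rewrite leqNgt rt => h; suff /h : E (varx k ^+ r) by [].
rewrite -[_ ^+ r]mulr1 -(expr0 (vary k)) mon_xy; apply/staircaseP => n.
by rewrite msuppX inE => /eqP ->; rewrite xdeg_bimon ydeg_bimon e0.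
Qed.

End Staircase.

Theorem corollary3p1 (k : fieldType) (E : {mpoly k[2]} -> Prop)
    (hE : monomial_ideal E) (hproper : ~ E 1)
    (d : nat) (hd : quot_dim E d)
    (s : nat) (hs : is_min (fun j => E (vary k ^+ j)) s)
    (t : nat) (ht : is_min (fun j => E (varx k ^+ j)) t)
    (m : nat -> nat)
    (hm : forall i, (i <= t)%N ->
       is_min (fun j => E (varx k ^+ (t - i) * vary k ^+ j)) (m i)) :
  exists (N : nat) (c : N.-tuple ('X_{1..2} * 'X_{1..2})),
    coef_index E c /\
    exists psi : 'rV[k]_(d + s) -> {mpoly k[2]} -> Prop,
      affine_space_iso E c psi /\
      exists J1 J2 J3 : {set 'I_(d + s)},
        [/\ coord_subspace psi (V1 E) J1 /\ #|~: J1| = d,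
            coord_subspace psi (V2 E) J2 /\ (#|~: J2| + t)%N = d
          & coord_subspace psi (V3 E) J3 /\ #|~: J3| = #|SE t m|].
Proof.
pose D := step_size t m.
have D_high : forall r, (t <= r)%N -> D r = 0%N by apply: step_size_high.
have EP := staircaseP hE ht hm; rewrite -/D in EP.
have muE r : (r <= t)%N -> mu t D r = m (t - r)%N by apply: (mu_step_size hE ht hm).
have mu_gt0 r : (r < t)%N -> (0 < mu t D r)%N by apply: (mu_step_size_gt0 hE ht hm).
have t_gt0 : (0 < t)%N.
  by rewrite lt0n; apply: contra_notN hproper => /eqP t0; have := ht.1;
    rewrite t0 expr0.
have sE : s = mu t D 0.
  rewrite muE // subn0; have [h1 h2] := hm t (leqnn t); rewrite subnn in h1 h2.
  apply/eqP; rewrite eqn_leq; apply/andP; split.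
    by apply: hs.2; rewrite -[_ ^+ _]mul1r -(expr0 (varx k)).
  by apply: h2; rewrite expr0 mul1r; apply: hs.1.
have dE := quot_dim_std EP hd.
have size_n : size (param_index t D) = (d + s)%N by rewrite size_param_index dE sE.
have [N [c cP]] := coef_index_exists D_high EP.
have c_lt i : lexlt (tnth c i).2 (tnth c i).1.
  by case ci : (tnth c i) => [m1 m2]; have [] := (cP.2 m1 m2).1;
    rewrite // -ci mem_tnth.
exists N, c; split=> //; exists (fun a => param_ideal t D (param_value t D a)); split.
  split.
  - by move=> a; apply: param_ideal_V0.
  - move=> a b psi_eq; apply/rowP => i; case e : (index_triple t D i) => [[r l] p].
    have pe : param_eq t D (param_value t D a) (param_value t D b).
      apply: (span_ideal_inj D_high) => q; have [f <-] := phi_surj q.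
      exact: (psi_eq f).1.
    by rewrite (param_eq_param_value size_n pe e) (param_value_index_triple size_n b e).
  - move=> I VI; have [iI lI] := (V0_lead D_high EP I).1 VI.
    have [f [shf If]] := lead_family lI.
    pose a : 'rV[k]_(d + s) := \row_i (let: (r, l, p) :=
      index_triple t D i in norm_param f r l p).
    have pe : param_eq t D (norm_param f) (param_value t D a).
      move=> r l p rt lr pD.
      have [i e] : exists i : 'I_(d + s), index_triple t D i = (r, l, p).
        by apply: (index_triple_ex size_n); rewrite mem_param_index rt lr pD.
      by rewrite (param_value_index_triple size_n a e) mxE e.
    have pe' : param_eq t D (param_value t D a) (norm_param f) by move=> r l p *;
      rewrite pe.
    exists a => g; rewrite -push_phi (lead_ideal_norm_param D_high lI shf If).
    by split; apply: (eq_span_ideal D_high).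
  (* G reads the coefficients of the normal forms at the generic point, and F
     normalizes the leading family with generic coefficients. *)
  pose gfa := @generic_param k t D (d + s).
  pose gc i := normal_form t D gfa (xdeg (tnth c i).1) (ydeg (tnth c i).1).
  pose G := [tuple (gc i)`_(xdeg (tnth c i).2)`_(ydeg (tnth c i).2) | i < N].
  pose gl := generic_lead t D c (fun i : 'I_N => 'X_i : {mpoly k[N]}).
  pose F := [tuple let: (r, l, p) :=
    index_triple t D i in norm_param gl r l p | i < d + s].
  have coefG a lam : coef_vector E c (param_ideal t D (param_value t D a)) lam <->
    lam = poly_map G a.
    rewrite (coef_vectorP D_high EP cP).
    have Ge i : (poly_map G a) 0 i =
      normal_form_coef t D (param_value t D a) (tnth c i).
      rewrite mxE tnth_mktuple /normal_form_coef -(map_normal_form t D (meval (a 0))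
        gfa).
      by rewrite !coef_map.
    split=> [h|-> i]; last exact: Ge.
    by apply/rowP => i; rewrite h Ge.
  exists F, G; split=> // a.
  (* The normalization of the leading family read off the reduced Groebner basis
     of the ideal with parameters a gives parameters of that same ideal. *)
  set lam := poly_map G a.
  have [gen _ _] := (coefG a lam).2 erefl.
  have [iI _] := param_ideal_V0 D_high EP (param_value t D a).
  have In n : min_gen E n ->
    param_ideal t D (param_value t D a) (groebner_poly c lam n).
    by move=> gn; apply: (gen _ _).1; exists n.
  have shg : shaped t D gl by apply: generic_lead_shaped.
  pose fl r := map_poly (map_poly (meval (lam 0))) (gl r).
  have shl : shaped t D fl by apply: map_shaped.
  have lJ := span_ideal_lead_ideal D_high (param_value t D a).
  have lIn r : span_ideal t D (param_value t D a) (fl r).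
    rewrite /fl map_generic_lead (eq_generic_lead t D c (lam2 := lam 0)) => [|j];
      last exact: mevalXU.
    by apply/push_param_ideal; apply: (generic_lead_in D_high EP iI In).
  have pe : param_eq t D (param_value t D a) (norm_param fl).
    by apply: (span_ideal_inj D_high) => q /(lead_ideal_norm_param D_high lJ shl lIn).
  apply/rowP => i; rewrite mxE tnth_mktuple; case e : (index_triple t D i) => [[r l] p].
  by rewrite (param_eq_param_value size_n pe e) (map_norm_param D_high (meval (lam
    0)) shg).
(* V_1 is cut out by the parameters with indices in P1, and V_2 and V_3 by
   those together with the indices in P2 and in P3. *)
pose P1 (z : nat * nat * nat) := z.1.2 == z.1.1.+1.
pose P2 (z : nat * nat * nat) :=
  ((z.2 == 0) && (\sum_(z.1.2 <= q < z.1.1) D q == 0))%N.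
pose P3 (z : nat * nat * nat) := (z.2 + wt t D z.1.2 != (wt t D z.1.1).+1)%N.
pose free (P : pred (nat * nat * nat)) : {set 'I_(d + s)} :=
  [set i | P (index_triple t D i)].
exists (free P1), (free (fun z => P1 z || P2 z)), (free (fun z => P1 z || P3 z)).
have c1E a : diag_trivial t D (param_value t D a) <->
    forall r l p, (r, l, p) \in param_index t D -> P1 (r, l, p) ->
      param_value t D a r l p = 0.
  split=> h r p; last by move=> rt pD; apply: h;
    rewrite ?mem_param_index ?rt ?pD /P1 ?leqnn //=.
  by move=> q; rewrite mem_param_index => /and3P[rt _ qD] /eqP /= ->; apply: h.
split; split.
- by move=> a; rewrite (V1_cond D_high EP) c1E param_value_vanish.
- rewrite card_free // dE -count_lower_all; exact: eq_count.
- move=> a; rewrite (V2_cond D_high EP) // -param_value_vanish //; split.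
    case=> /c1E c1 c2 r l p rlp /orP[P1z|/andP[/eqP /= p0 z]]; first exact: c1.
    move: rlp; rewrite p0 mem_param_index => /and3P[rt lr Dr].
    move: lr; rewrite leq_eqVlt => /predU1P[e|lr]; last exact: c2.
    by apply: c1; rewrite /P1 /= ?mem_param_index ?rt ?e ?leqnn ?eqxx.
  move=> h; split; first by apply/c1E => r l p rlp P1z; apply: h; rewrite ?P1z.
  move=> r l rt lr Dr z; apply: h; first by rewrite mem_param_index rt leqW.
  by rewrite /P2 /= z orbT.
- rewrite card_free // dE -(count_free2 mu_gt0); congr (_ + t)%N; apply: eq_count => z.
  by rewrite /= negb_or.
- move=> a; rewrite (V3_cond D_high EP) // -param_value_vanish //; split.
    case=> /c1E c1 c3 r l p rlp; rewrite /P1 /P3 /=; case: eqP => [e _|/eqP ne /= hp].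
      by apply: c1; rewrite // /P1 e /=.
    move: rlp; rewrite mem_param_index => /and3P[rt lr pD]; apply: c3 => //.
    by rewrite -ltnS ltn_neqAle ne.
  move=> h; split; first by apply/c1E => r l p rlp P1z; apply: h; rewrite ?P1z.
  move=> r l p rt lr pD ne; apply: h; first by rewrite mem_param_index rt leqW.
  by rewrite /P3 /= ne orbT.
rewrite card_free // -(card_SE D_high muE); apply: eq_count => z.
by rewrite /= negb_or negbK.
Qed.
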